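(* Let $(\Omega,d)$ be a separable metric space, $\Theta\subset\mathbb R^p$ open, $\{\mu_\theta:\theta\in\Theta\}$ a family of Borel probability measures on $\Omega$, $\theta_0\in\Theta$, and $G$ a Borel probability measure on $\Omega$ for which there is $K_G>0$ with $\sup_{\omega\in\Omega}|F_\omega^G(r)-F_\omega^G(s)|\le K_G|r-s|$ for all $r,s\ge0$. For each $n$, let $X_1,\ldots,X_n$ be iid with law $Q_n=(1-n^{-1/2})\mu_{\theta_0}+n^{-1/2}G$ (local alternative), with empirical measure $P_n$. Let $\psi_\theta:\Omega\to\mathbb R^p$ be measurable functions such that: (1) there are a neighborhood of $\theta_0$ and a measurable function $L$ with $\mathsf E_{\mu_{\theta_0}}(L(X)^2)<\infty$ such that $\|\psi_{\theta_1}(x)-\psi_{\theta_2}(x)\|\le L(x)\|\theta_1-\theta_2\|$ for all $\theta_1,\theta_2$ in this neighborhood and all $x$; (2) $\mathsf E_{\mu_{\theta_0}}(\|\psi_{\theta_0}(X)\|^2)<\infty$; (3) the map $\theta\mapsto\mathsf E_{\mu_{\theta_0}}(\psi_\theta(X))$ is zero at $\theta_0$ and differentiable at $\theta_0$ with non-singular derivative matrix $V_{\theta_0}$; (4) $\mathsf E_G(L(X)^2)<\infty$ and $\mathsf E_G\|\psi_{\theta_0}(X)\|^2<\infty$. Let $\tilde\theta_n\in\Theta$ be such that $\mathsf E_{Q_n}(\psi_{\tilde\theta_n}(X))=0$ and $\tilde\theta_n\to\theta_0$. Then, under the local alternative: (i) $$\tilde\theta_n-\theta_0=-\frac1{\sqrt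 n}V_{\theta_0}^{-1}\mathsf E_G\big(\psi_{\theta_0}(X)\big)+o(n^{-1/2}).$$ (ii) If $\hat\theta\in\Theta$ (an estimator based on $X_1,\ldots,X_n$) is such that $\mathsf E_{P_n}(\psi_{\hat\theta}(X))=\frac1n\sum_{i=1}^n\psi_{\hat\theta}(X_i)=o_{\mathsf P}(n^{-1/2})$ and $\hat\theta\to\theta_0$ in probability, then $$\hat\theta-\theta_0=-\frac1nV_{\theta_0}^{-1}\sum_{i=1}^n\psi_{\tilde\theta_n}(X_i)-\frac1{\sqrt n}V_{\theta_0}^{-1}\mathsf E_G\big(\psi_{\theta_0}(X)\big)+o_{\mathsf P}(n^{-1/2}).$$
   Context: $\mathsf E_\nu$ denotes expectation for $X\sim\nu$. For a Borel probability measure $\nu$ on $\Omega$, $F_\omega^\nu(t)=\nu(\{x:d(\omega,x)\le t\})$, $t\ge0$, is its distance profile at $\omega$. All stochastic orders are under sampling from $Q_n$. Standing assumptions: (b1) $\varepsilon\log N(\varepsilon,\Omega,d)\to0$ as $\varepsilon\to0^+$, with $N(\varepsilon,\Omega,d)$ the covering number. (b2') for $\nu=\mu_{\theta_0}$ there is $K_\nu>0$ with $\sup_{\omega\in\Omega}|F_\omega^\nu(r)-F_\omega^\nu(s)|\le K_\nu|r-s|$ for all $r,s\ge0$. At least one of: (a1) there is $\alpha>0$ such that $(\Omega,d^\alpha)$ is of strong negative type (negative type, and $\iint d^\alpha(x,y)\,\mathrm d(\nu_1-\nu_2)(x)\,\mathrm d(\nu_1-\nu_2)(y)=0$ only if $\nu_1=\nu_2$,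 for Borel probability measures with finite first moment with respect to $d^\alpha$); (a2) the probability measures under consideration satisfy the doubling condition: for each such $\nu$ there is $L_\nu<\infty$ with $\limsup_{r\to0^+}\nu(B(\omega,2r))/\nu(B(\omega,r))\le L_\nu$ for every $\omega\in\mathrm{supp}(\nu)$. *)

(* Defs.v *)
From HB Require Import structures.
From mathcomp Require Import all_boot all_order all_algebra.
From mathcomp Require Import all_classical all_reals all_analysis.

Set Implicit Arguments.
Unset Strict Implicit.
Unset Printing Implicit Defensive.

Import Order.TTheory GRing.Theory Num.Def Num.Theory.
Import numFieldNormedType.Exports.

Local Open Scope classical_set_scope.
Local Open Scope ring_scope.

(* [g_sigma_algebraType] needs a pointed carrier; pointedness only says that
   the metric space is nonempty, which the existence of a probability measure
   on it forces anyway. *)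
#[short(type="pmetricType")]
HB.structure Definition PMetric (K : numDomainType) :=
  {M of Pointed M & Metric K M}.

Notation borel T := (g_sigma_algebraType (@open T)).

Definition separable (T : topologicalType) : Prop :=
  exists2 S : set T, countable S & dense S.

Section euclidean.
Context {R : realType}.

(* The library norm on matrices is the sup norm. *)
Definition enorm (p : nat) (v : 'cV[R]_p) : R :=
  Num.sqrt (\sum_j v j ord0 ^+ 2).

Context d (T : measurableType d) (P : probability T R).

(* Meaningful when the coordinates of [f] are integrable. *)
Definition vexpectation (p : nat) (f : T -> 'cV[R]_p) : 'cV[R]_p :=
  \col_j fine 'E_P[fun x => f x j ord0]%E.

(* The expectation of [f] exists, is finite and equals [m]: an extended-real
   integral is finite only if the integrand is integrable. *)
Definition expectation_is (p : nat) (f : T -> 'cV[R]_p) (m : 'cV[R]_p) : Prop :=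
  forall j, ('E_P[fun x => f x j ord0] = (m j ord0)%:E)%E.

End euclidean.

Section metric_measure.
Context {R : realType} (Omega : pmetricType R).
Implicit Types (nu : probability (borel Omega) R) (w : Omega) (alpha : R).

(* Equal to [+oo] when no finite cover exists. *)
Definition covering_number (e : R) : \bar R :=
  ereal_inf [set (n%:R)%:E | n in [set n : nat |
    exists c : 'I_n -> Omega, forall x, exists i, ball (c i) e x]].

Definition entropy_condition : Prop :=
  (e%:E * lne (covering_number e))%E @[e --> 0^'+] --> 0%E.

Definition distance_profile nu w (t : R) : R :=
  fine (nu [set x | mdist w x <= t]).

Definition lipschitz_profiles nu : Prop :=
  exists2 K : R, 0 < K & forall r s : R, 0 <= r -> 0 <= s ->
    (ereal_sup (range (fun w : Omega =>
        (`|distance_profile nu w r - distance_profile nu w s|)%:E))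
     <= (K * `|r - s|)%:E)%E.

Definition negative_type alpha : Prop :=
  forall (n : nat) (x : 'I_n -> Omega) (a : 'I_n -> R), \sum_i a i = 0 ->
    \sum_i \sum_j a i * a j * (mdist (x i) (x j) `^ alpha) <= 0.

Definition finite_first_moment alpha nu : Prop :=
  exists o : Omega, (\int[nu]_x (mdist o x `^ alpha)%:E < +oo)%E.

(* Integral of [f] against the signed measure [nu1 - nu2]. *)
Definition integral_diff nu1 nu2 (f : Omega -> \bar R) : \bar R :=
  (\int[nu1]_x f x - \int[nu2]_x f x)%E.

Definition strong_negative_type alpha : Prop :=
  negative_type alpha /\
  forall nu1 nu2,
    finite_first_moment alpha nu1 -> finite_first_moment alpha nu2 ->
    integral_diff nu1 nu2 (fun y =>
      integral_diff nu1 nu2 (fun x => (mdist x y `^ alpha)%:E)) = 0%E ->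
    forall A : set (borel Omega), measurable A -> nu1 A = nu2 A.

Definition measure_support nu : set Omega :=
  [set w | forall U, open_nbhs w U -> (0 < nu U)%E].

Definition doubling nu : Prop :=
  exists L : R, forall w, measure_support nu w ->
    (limf_esup (fun r : R =>
       (fine (nu (ball w (2 * r))) / fine (nu (ball w r)))%:E) 0^'+
     <= L%:E)%E.

End metric_measure.

Section local_alternative.
Context {R : realType}.

(* [n^(-1/2)]; it is [0] at [n = 0]. *)
Definition rate (n : nat) : R := (Num.sqrt n%:R)^-1.

Lemma rate_ge0 n : 0 <= rate n.
Proof. by rewrite invr_ge0 sqrtr_ge0. Qed.

Lemma onem_rate_ge0 n : 0 <= 1 - rate n.
Proof.
rewrite subr_ge0 /rate; case: n => [|n]; first by rewrite sqrtr0 invr0.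
by rewrite invf_le1 ?sqrtr_gt0 ?ltr0n// -[leLHS]sqrtr1 ler_sqrt ?ler1n.
Qed.

Context d (T : measurableType d) (mu G : probability T R) (n : nat).

Definition local_alternative : set T -> \bar R :=
  measure_add (mscale (NngNum (onem_rate_ge0 n)) mu)
              (mscale (NngNum (rate_ge0 n)) G).

HB.instance Definition _ := Measure.on local_alternative.

Let local_alternative_setT : local_alternative setT = 1%E.
Proof.
rewrite /local_alternative measure_addE /= /mscale/= !probability_setT !mule1.
by rewrite -EFinD subrK.
Qed.

HB.instance Definition _ :=
  Measure_isProbability.Build _ _ _ local_alternative local_alternative_setT.

End local_alternative.

Section sampling.
Context {R : realType}.

Definition mutually_independent d d' (T : measurableType d)
    (T' : measurableType d') (P : probability T R) (n : nat)
    (X : 'I_n -> {mfun T >-> T'}) : Prop :=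
  forall (J : {set 'I_n}) (A : 'I_n -> set T'), (forall i, measurable (A i)) ->
    P (\bigcap_(i in [set` J]) X i @^-1` A i) =
    (\prod_(i in J) fine (P (X i @^-1` A i)))%:E.

Definition iid d d' (T : measurableType d) (T' : measurableType d')
    (P : probability T R) (Q : probability T' R) (n : nat)
    (X : 'I_n -> {mfun T >-> T'}) : Prop :=
  (forall i A, measurable A -> distribution P (X i) A = Q A) /\
  mutually_independent P X.

(* [Z n = oP(a n)].  The outer measure [mu_ext] agrees with [P n] on events and
   is needed because [Z n] may fail to be measurable, e.g. when it contains
   [psi (thetahat)] while [psi] is not measurable in the parameter. *)
Definition negligible_in_prob (d : nat -> measure_display)
    (T : forall n, measurableType (d n)) (P : forall n, probability (T n) R)
    (p : nat) (Z : forall n, T n -> 'cV[R]_p) (a : nat -> R) : Prop :=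
  forall e : R, 0 < e ->
    mu_ext (P n) [set t | e * a n < enorm (Z n t)] @[n --> \oo] --> 0%E.

End sampling.

(* Main.v *)
Require Import Defs.
From HB Require Import structures.
From mathcomp Require Import all_boot all_order all_algebra.
From mathcomp Require Import all_classical all_reals all_analysis.
From mathcomp Require Import measurable_realfun.
From mathcomp Require Import ring lra.

Set Implicit Arguments.
Unset Strict Implicit.
Unset Printing Implicit Defensive.

Import Order.TTheory GRing.Theory Num.Def Num.Theory.
Import numFieldNormedType.Exports.

Local Open Scope classical_set_scope.
Local Open Scope ring_scope.

(** Both parts rest on one deterministic and one random estimate.

    Deterministic: because the mixture weight [rate n] tends to 0, the mean of
    the estimating function under the local alternative satisfies
    E_{Q_n} psi_theta = V (theta - theta0) + rate n * E_G psi_{theta0}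
    + o(|theta - theta0|), uniformly in n large ([drift_expansion]): the term
    coming from mu is the derivative at theta0, and everything else that mixing
    adds is Lipschitz in theta and multiplied by [rate n].  Evaluating at the
    pseudo-true value, where the left-hand side is 0, and inverting V gives
    part (i) ([pseudo_true_expansion]), and in particular
    |thetat n - theta0| = O(rate n).

    Random: for every eta > 0, with probability tending to 1, simultaneously
    for all theta in a ball around theta0,
    |(P_n - Q_n)(psi_theta - psi_{theta0})| <= eta (|theta - theta0| + rate n)
    ([uniform_deviation]).  This is weaker than asymptotic equicontinuity of
    the empirical process, since the bound is relative to |theta - theta0| and
    not to n^(-1/2), and for that reason it follows without any chaining.  The
    ball is cut into dyadic shells, and each shell is covered by a finite net
    whose mesh is a fixed fraction of the radius of the shell.  At a net point
    Chebyshev's inequality has error O(1/n), because the variance scales like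
    the square of the radius; the Lipschitz bound passes from the net to the
    shell.  Only O(sqrt n) shells lie outside the ball of radius
    O(rate n), so the union bound costs O(n^(-1/2)), and inside that small
    ball the Lipschitz bound alone suffices.

    For part (ii), set D = V (thetahat - theta0) + rate n * E_G psi_{theta0}
    + P_n psi_{thetat n}.  Both estimates together bound |D| by
    o_P(|thetahat - theta0| + rate n), whereas solving for thetahat - theta0
    bounds |thetahat - theta0| by O(|D|) + O_P(rate n), because
    P_n psi_{thetat n} = O_P(rate n) by Chebyshev.  Feeding the second bound
    into the first absorbs the |D| on the right, so D = o_P(rate n)
    ([estimator_expansion]); the claimed remainder is V^(-1) D.  The rate of
    thetahat is thus a by-product of the argument.

    Sets of outcomes that quantify over all theta, or that involve
    psi_{thetahat}, may fail to be measurable, so everything is carried out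
    with outer probabilities.  Column vectors are measured in the sup norm,
    which is equivalent to the Euclidean one. *)

(** * Products of independent variables *)

Section product_expectation.
Local Open Scope ereal_scope.
Context {R : realType} d d' (T : measurableType d) (T' : measurableType d')
  (P : probability T R).

(** Independence makes the law of the pair a product measure, since the two
    agree on rectangles; the identity is then Fubini's theorem. *)
Lemma expectation_mul_indep (X Y : {mfun T >-> T'}) (f g : T' -> R) :
    measurable_fun setT f -> measurable_fun setT g ->
    (f \o X)%FUN \in Lfun P 2%:E -> (g \o Y)%FUN \in Lfun P 2%:E ->
    (forall A B, measurable A -> measurable B ->
      P (X @^-1` A `&` Y @^-1` B) = P (X @^-1` A) * P (Y @^-1` B)) ->
  'E_P[fun t => f (X t) * g (Y t)]%R = 'E_P[f \o X] * 'E_P[g \o Y].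
Proof.
move=> mf mg fX gY XY.
have PT : P setT \is a fin_num by rewrite probability_setT.
have fX1 : P.-integrable setT (EFin \o (f \o X)).
  exact/Lfun1_integrable/(Lfun_subset12 PT).
have gY1 : P.-integrable setT (EFin \o (g \o Y)).
  exact/Lfun1_integrable/(Lfun_subset12 PT).
have fgXY : P.-integrable setT (EFin \o (fun t => f (X t) * g (Y t))%R).
  exact/Lfun1_integrable/(Lfun2_mul_Lfun1 fX gY).
pose Z t := (X t, Y t).
have mZ : measurable_fun setT Z by exact/measurable_fun_pair.
pose h (z : T' * T') := (f z.1 * g z.2)%:E.
have mh : measurable_fun setT h.
  apply/measurable_EFinP/measurable_funM.
    exact: measurableT_comp mf measurable_fst.
  exact: measurableT_comp mg measurable_snd.
pose DX : probability T' R := distribution P X.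
pose DY : probability T' R := distribution P Y.
have lawZ A : measurable A -> (DX \x DY) A = pushforward P Z A.
  apply: product_measure_unique => B C mB mC.
  by rewrite /pushforward -XY.
have hZ : 'E_P[fun t => f (X t) * g (Y t)]%R = \int[pushforward P Z]_z h z.
  by rewrite unlock integral_pushforward.
have hDD : \int[pushforward P Z]_z h z = \int[DX \x DY]_z h z.
  by apply: eq_measure_integral => A mA _; exact/esym/lawZ.
have ih : (DX \x DY).-integrable setT h.
  apply/integrableP; split => //.
  rewrite (_ : \int[_]_x _ = \int[pushforward P Z]_x `|h x|); last first.
    by apply: eq_measure_integral => A mA _; exact: lawZ.
  rewrite ge0_integral_pushforward//; last exact: measurableT_comp.
  by case/integrableP: fgXY.
have fDX : DX.-integrable setT (EFin \o f).
  apply/integrableP; split; first exact/measurable_EFinP.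
  rewrite ge0_integral_distribution//; last first.
    by apply: measurableT_comp => //; exact/measurable_EFinP.
  by case/integrableP: fX1.
have gDY : DY.-integrable setT (EFin \o g).
  apply/integrableP; split; first exact/measurable_EFinP.
  rewrite ge0_integral_distribution//; last first.
    by apply: measurableT_comp => //; exact/measurable_EFinP.
  by case/integrableP: gY1.
rewrite hZ hDD -integral12_prod_meas1// /fubini_F.
have Ef : 'E_P[f \o X] = \int[DX]_x (f x)%:E.
  by rewrite unlock integral_distribution//; exact/measurable_EFinP.
have Eg : 'E_P[g \o Y] = \int[DY]_x (g x)%:E.
  by rewrite unlock integral_distribution//; exact/measurable_EFinP.
rewrite Ef Eg.
under eq_integral => x _.
  rewrite /h /=.
  under eq_integral do rewrite EFinM.
  rewrite integralZl// muleC.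
  over.
have /fineK <- : \int[DY]_x (g x)%:E \is a fin_num by exact: integrable_fin_num.
by rewrite integralZl// muleC.
Qed.

End product_expectation.

(** * Sample means of iid observations *)

Section square_integrable.
Local Open Scope ereal_scope.
Context {R : realType} d (T : measurableType d) (P : probability T R).

Lemma measurable_Lfun2 (f : T -> R) : measurable_fun setT f ->
  'E_P[fun x => f x ^+ 2]%R < +oo -> f \in Lfun P 2%:E.
Proof.
move=> mf f2; rewrite inE; apply/andP; split; rewrite inE//=.
rewrite /finite_norm unlock poweR_lty//.
move: f2; rewrite unlock; apply: le_lt_trans.
rewrite le_eqVlt; apply/orP; left; apply/eqP; apply: eq_integral => x _.
by rewrite /= powR_mulrn// real_normK// num_real.
Qed.

Lemma Lfun2_measurable (f : T -> R) : f \in Lfun P 2%:E ->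
  measurable_fun setT f.
Proof. by rewrite inE => /andP[+ _]; rewrite inE. Qed.

Lemma Lfun2_integrable (f : T -> R) : f \in Lfun P 2%:E ->
  P.-integrable setT (EFin \o f).
Proof.
by move=> /(Lfun_subset12 (fin_num_measure P _ measurableT))/Lfun1_integrable.
Qed.

Lemma Lfun2_expectation_fin_num (f : T -> R) : f \in Lfun P 2%:E ->
  'E_P[f] \is a fin_num.
Proof. by move=> /Lfun2_integrable ?; rewrite unlock integrable_fin_num. Qed.

Lemma Lfun2_sqr_fin_num (f : T -> R) : f \in Lfun P 2%:E ->
  'E_P[fun x => f x ^+ 2]%R \is a fin_num.
Proof.
by move=> /Lfun2_integrable_sqr ?; rewrite unlock integrable_fin_num.
Qed.

Lemma Lfun2B (f g : T -> R) : f \in Lfun P 2%:E -> g \in Lfun P 2%:E ->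
  (fun x => f x - g x)%R \in Lfun P 2%:E.
Proof. by move=> ? ?; rewrite (_ : (fun _ => _) = f - g)%R// rpredB// lee1n. Qed.

Lemma expectation_sqr_center (f : T -> R) : f \in Lfun P 2%:E ->
  'E_P[fun x => (f x - fine 'E_P[f]) ^+ 2]%R <= 'E_P[fun x => f x ^+ 2]%R.
Proof.
move=> f2; have := varianceE f2.
rewrite /variance unlock.
rewrite [X in 'E_P[X]](_ : _ = fun x => (f x - fine 'E_P[f]) ^+ 2)%R//.
move=> ->; rewrite leeBlDr ?leeDl ?sqre_ge0//.
by rewrite fin_numX// Lfun2_expectation_fin_num.
Qed.

Lemma sqr_markov (Y : T -> R) (c : R) : measurable_fun setT Y -> (0 < c)%R ->
  P [set t | (c <= `|Y t|)%R] <= (c ^- 2)%:E * 'E_P[fun t => Y t ^+ 2]%R.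
Proof.
move=> mY c0.
pose Y' : {mfun T >-> R} := mfun_Sub (mem_set mY).
rewrite -lee_pdivrMl; last by rewrite invr_gt0// exprn_gt0.
rewrite invrK.
have := @markov _ _ _ P Y' (fun r => r ^+ 2)%R c c0.
rewrite (_ : (_ \o _) \o _ = fun t => Y t ^+ 2)%R; last first.
  by apply/funext => t /=; rewrite real_normK// num_real.
apply => //.
- by move=> r _; exact: sqr_ge0.
- by move=> x y; rewrite !nnegrE => x0 y0; rewrite ler_sqr.
Qed.

End square_integrable.

Section sample_mean.
Local Open Scope ereal_scope.
Context {R : realType} d d' (T : measurableType d) (T' : measurableType d')
  (P : probability T R) (Q : probability T' R).

Definition sample_mean n (X : 'I_n -> T -> T') (h : T' -> R) (t : T) : R :=
  (n%:R^-1 * \sum_(i < n) h (X i t))%R.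

Lemma expectation_same_law (X : {mfun T >-> T'}) (f : T' -> R) :
    (forall A, measurable A -> distribution P X A = Q A) ->
    measurable_fun setT f -> (forall x, 0 <= f x)%R ->
  'E_P[f \o X] = 'E_Q[f].
Proof.
move=> XQ mf f0; rewrite unlock.
rewrite (eq_measure_integral (distribution P X)); last first.
  by move=> A mA _; exact/esym/XQ.
by rewrite ge0_integral_distribution//; exact/measurable_EFinP.
Qed.

Lemma Lfun2_same_law (X : {mfun T >-> T'}) (f : T' -> R) :
    (forall A, measurable A -> distribution P X A = Q A) ->
  f \in Lfun Q 2%:E -> (f \o X)%FUN \in Lfun P 2%:E.
Proof.
move=> XQ f2; have mf := Lfun2_measurable f2.
apply: measurable_Lfun2; first exact: measurableT_comp.
rewrite -[X in X < _]/('E_P[(fun x => f x ^+ 2)%R \o X]).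
rewrite expectation_same_law//; last 2 first.
- exact: measurable_funX.
- by move=> x; exact: sqr_ge0.
by rewrite ltey_eq Lfun2_sqr_fin_num.
Qed.

Lemma expectation_same_law_Lfun2 (X : {mfun T >-> T'}) (f : T' -> R) :
    (forall A, measurable A -> distribution P X A = Q A) ->
    f \in Lfun Q 2%:E -> 'E_P[f \o X] = 'E_Q[f].
Proof.
move=> XQ f2; have mf := Lfun2_measurable f2; rewrite unlock.
rewrite [RHS](eq_measure_integral (distribution P X)); last first.
  by move=> A mA _; exact/esym/XQ.
rewrite integral_distribution//; first exact/measurable_EFinP.
exact/Lfun2_integrable/Lfun2_same_law.
Qed.

Lemma iid_pair n (X : 'I_n -> {mfun T >-> T'}) (i j : 'I_n) : iid P Q X ->
    i != j -> forall A B, measurable A -> measurable B ->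
  P (X i @^-1` A `&` X j @^-1` B) = P (X i @^-1` A) * P (X j @^-1` B).
Proof.
move=> [_ ind] ij A B mA mB.
have ji : (j == i) = false by rewrite eq_sym (negbTE ij).
have := ind [set i; j]%SET (fun k => if k == i then A else B).
have /[swap]/[apply] : forall k, measurable (if k == i then A else B).
  by move=> k; case: ifP.
rewrite (_ : \bigcap_(_ in _) _ = X i @^-1` A `&` X j @^-1` B); last first.
  apply/seteqP; split=> t /=.
    move=> H; split.
      by have := H i; rewrite /= !inE eqxx; apply.
    by have := H j; rewrite /= !inE eqxx orbT ji; apply.
  by move=> [Ai Bj] k; rewrite /= !inE => /orP[] /eqP->; rewrite ?eqxx ?ji.
move=> ->; rewrite big_setU1 ?inE//= big_set1 eqxx ji EFinM.
have fin C k : measurable C -> P (X k @^-1` C) \is a fin_num.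
  move=> mC; apply: fin_num_measure.
  exact: measurable_funPTI.
by rewrite !fineK ?fin.
Qed.

(** The off-diagonal terms of the square are products of independent centered
    variables, so only the n diagonal terms survive. *)
Lemma expectation_sqr_sum n (X : 'I_n -> {mfun T >-> T'}) (k : T' -> R) :
    iid P Q X -> k \in Lfun Q 2%:E -> 'E_Q[k] = 0 ->
  'E_P[fun t => (\sum_(i < n) k (X i t)) ^+ 2]%R =
    n%:R%:E * 'E_Q[fun x => k x ^+ 2]%R.
Proof.
move=> XQ k2 k0; have mk := Lfun2_measurable k2.
have law i := XQ.1 i.
have kX i : (k \o X i)%FUN \in Lfun P 2%:E.
  exact: (Lfun2_same_law (law i) k2).
have ikk i j : P.-integrable setT (EFin \o (fun t => k (X i t) * k (X j t))%R).
  exact/Lfun1_integrable/(Lfun2_mul_Lfun1 (kX i) (kX j)).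
have EP f : 'E_P[f] = \int[P]_t (f t)%:E by rewrite unlock.
rewrite EP.
under eq_integral => t _.
  rewrite expr2 mulr_suml -sumEFin.
  under eq_bigr do rewrite mulr_sumr -sumEFin.
  over.
rewrite /= integral_sum//; last first.
  by move=> i; apply: integrable_sum => // j _; exact: ikk.
transitivity (\sum_(i < n) 'E_Q[fun x => k x ^+ 2]%R); last first.
  rewrite -(fineK (Lfun2_sqr_fin_num k2)) sumEFin -EFinM.
  by rewrite sumr_const card_ord mulr_natl.
apply: eq_bigr => i _.
rewrite integral_sum//; last exact: ikk.
rewrite (bigD1 i)//= [X in _ + X]big1 ?adde0; last first.
  move=> j ji.
  have := expectation_mul_indep mk mk (kX i) (kX j)
    (iid_pair XQ _).
  rewrite (expectation_same_law_Lfun2 (law i) k2) k0 mul0e EP.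
  by apply; rewrite eq_sym.
rewrite -(expectation_same_law (law i) (f := fun x => (k x ^+ 2)%R)).
- by rewrite EP; apply: eq_integral => t _; rewrite /= expr2.
- exact: measurable_funX.
- by move=> x; exact: sqr_ge0.
Qed.

Lemma measurable_sample_mean n (X : 'I_n -> {mfun T >-> T'}) (h : T' -> R) :
  measurable_fun setT h -> measurable_fun setT (sample_mean X h).
Proof.
move=> mh; apply: measurable_funM => //; apply: measurable_sum => i.
exact: measurableT_comp.
Qed.

(** Chebyshev's inequality for a sample mean, with the second moment in place
    of the variance: the second moment is what a Lipschitz bound controls. *)
Lemma sample_mean_deviation n (X : 'I_n -> {mfun T >-> T'}) (h : T' -> R)
    (c : R) : (0 < n)%N -> iid P Q X -> h \in Lfun Q 2%:E -> (0 < c)%R ->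
  P [set t | (c <= `|sample_mean X h t - fine 'E_Q[h]|)%R] <=
    ((n%:R * c ^+ 2)^-1)%:E * 'E_Q[fun x => h x ^+ 2]%R.
Proof.
move=> n0 XQ h2 c0; have mh := Lfun2_measurable h2.
set m := fine 'E_Q[h].
pose k x := (h x - m)%R.
have k2 : k \in Lfun Q 2%:E by apply: Lfun2B => //; exact: Lfun_cst.
have k0 : 'E_Q[k] = 0.
  rewrite (_ : k = h \- cst m)%R// expectationB; last 2 first.
  - exact/Lfun1_integrable/Lfun2_integrable.
  - by apply/Lfun1_integrable/Lfun2_integrable; exact: Lfun_cst.
  by rewrite expectation_cst fineK ?subee// Lfun2_expectation_fin_num.
have nR0 : (0 < n%:R :> R)%R by rewrite ltr0n.
have sumk t : (\sum_(i < n) k (X i t) = n%:R * (sample_mean X h t - m))%R.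
  rewrite /sample_mean mulrBr mulrA mulfV ?gt_eqF// mul1r sumrB.
  by rewrite sumr_const card_ord mulr_natl.
have -> : [set t | (c <= `|sample_mean X h t - m|)%R] =
    [set t | (n%:R * c <= `|\sum_(i < n) k (X i t)|)%R].
  apply: eq_set => t.
  by rewrite sumk normrM ger0_norm ?ler0n// ler_pM2l.
have mS : measurable_fun setT (fun t => \sum_(i < n) k (X i t))%R.
  apply: measurable_sum => i; apply: measurableT_comp => //.
  exact: Lfun2_measurable k2.
apply: (le_trans (sqr_markov P mS (mulr_gt0 nR0 c0))).
rewrite (expectation_sqr_sum XQ k2 k0) muleA -EFinM.
rewrite (_ : _ * _ = (n%:R * c ^+ 2)^-1)%R; last first.
  by field; rewrite !gt_eqF.
rewrite lee_pmul2l ?lte_fin ?invr_gt0 ?mulr_gt0 ?exprn_gt0//.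
exact: expectation_sqr_center.
Qed.

End sample_mean.

(** * Outer probability *)

Section outer_probability.
Local Open Scope ereal_scope.
Context {R : realType} d (T : measurableType d) (P : probability T R).

Lemma mu_extU (A B : set T) : mu_ext P (A `|` B) <= mu_ext P A + mu_ext P B.
Proof. exact: (outer_measureU2 (mu_ext P)). Qed.

Lemma mu_ext_exists (I : finType) (A : I -> set T) (c : R) :
    (forall i, mu_ext P (A i) <= c%:E) ->
  mu_ext P [set t | exists i, A i t] <= (#|I|%:R * c)%:E.
Proof.
move=> Ac.
pose B (s : seq I) := [set t | exists2 i, i \in s & A i t].
suff Bc (s : seq I) : mu_ext P (B s) <= ((size s)%:R * c)%:E.
  rewrite cardE; apply: le_trans (Bc (enum I)); apply: le_mu_ext.
  by move=> t [i Ai]; exists i => //; rewrite mem_enum.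
elim: s => [|i s ih].
  rewrite mul0r (_ : B [::] = set0); last first.
    by apply/seteqP; split => t // -[].
  by rewrite (mu_ext0 (measure0 P) (measure_ge0 P)).
apply: (@le_trans _ _ (mu_ext P (A i `|` B s))).
  apply: le_mu_ext => t [k]; rewrite inE => /predU1P[-> ?|ks ?]; first by left.
  by right; exists k.
rewrite (le_trans (mu_extU _ _))//= -addn1 natrD mulrDl mul1r addrC EFinD.
exact: leeD.
Qed.

End outer_probability.

Section vanishing.
Context {R : realType} (d : nat -> measure_display)
  (T : forall n, measurableType (d n)) (P : forall n, probability (T n) R).
Implicit Types A B : forall n, set (T n).

(** The events are only assumed to be sets, whence the outer measure;
    [negligible_in_prob P Z a] says that, for every [e > 0], the events
    [e * a n < enorm (Z n _)] are vanishing. *)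
Definition vanishing A := mu_ext (P n) (A n) @[n --> \oo] --> 0%E.

Lemma vanishing_le A (b : nat -> R) : b @ \oo --> 0 ->
  (\forall n \near \oo, mu_ext (P n) (A n) <= (b n)%:E)%E -> vanishing A.
Proof.
move=> b0 Ab; rewrite /vanishing.
apply: (squeeze_cvge (f := fun=> 0%E) (h := EFin \o b)).
- near=> n; apply/andP; split; last by near: n.
  exact: (mu_ext_ge0 (measure_ge0 (P n))).
- exact: cvg_cst.
- by apply/fine_cvgP; split; [exact: nearW|].
Unshelve. all: by end_near. Qed.

Lemma vanishingP A : vanishing A <-> forall e : R, 0 < e ->
  (\forall n \near \oo, mu_ext (P n) (A n) <= e%:E)%E.
Proof.
split=> [A0 e e0|Ae].
  have A0e : nbhs (0%E : \bar R) [set x : \bar R | (x < e%:E)%E].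
    apply: open_nbhs_nbhs; split; last by rewrite /= lte_fin.
    exact: open_ereal_lt_ereal.
  near=> n; apply: ltW; near: n; exact: A0 A0e.
have ge0 n : (0 <= mu_ext (P n) (A n))%E.
  exact: (mu_ext_ge0 (measure_ge0 (P n))).
have fin e n : (mu_ext (P n) (A n) <= e%:E)%E -> mu_ext (P n) (A n) \is a fin_num.
  by move=> Ane; rewrite ge0_fin_numE// (le_lt_trans Ane)// ltry.
apply/fine_cvgP; split.
  by have := Ae _ ltr01; apply: filterS => n; exact: fin.
apply/cvgr0Pnorm_le => e e0; have := Ae _ e0; apply: filterS => n Ane /=.
by rewrite ger0_norm ?fine_ge0// -lee_fin fineK// (fin e).
Unshelve. all: by end_near. Qed.

Lemma vanishing_sub A B : vanishing B ->
  (\forall n \near \oo, A n `<=` B n) -> vanishing A.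
Proof.
move=> /vanishingP B0 AB; apply/vanishingP => e e0; have := B0 _ e0.
apply: filterS2 AB => n AB; apply: le_trans; exact: le_mu_ext.
Qed.

Lemma vanishingU A B : vanishing A -> vanishing B ->
  vanishing (fun n => A n `|` B n).
Proof.
move=> /vanishingP A0 /vanishingP B0; apply/vanishingP => e e0.
have e2 : 0 < e / 2 by rewrite divr_gt0.
apply: filterS2 (A0 _ e2) (B0 _ e2) => n An Bn.
by rewrite (le_trans (mu_extU _ _ _))// (splitr e) EFinD leeD.
Qed.

Lemma vanishing_exists (I : finType) (A : I -> forall n, set (T n)) :
    (forall i, vanishing (A i)) ->
  vanishing (fun n => [set t | exists i, A i n t]).
Proof.
move=> A0; apply/vanishingP => e e0.
have [I0|I0] := posnP #|I|.
  near=> n; rewrite (le_trans (@mu_ext_exists _ _ _ (P n) I (A^~ n) 0 _))//.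
    by move=> i; have := card0_eq I0 i; rewrite inE.
  by rewrite mulr0 lee_fin ltW.
have eI : 0 < e / #|I|%:R by rewrite divr_gt0// ltr0n.
have : \forall n \near \oo, forall i, (mu_ext (P n) (A i n) <= (e / #|I|%:R)%:E)%E.
  by apply: filter_forall => i; have /vanishingP := A0 i; exact.
apply: filterS => n An.
rewrite (le_trans (mu_ext_exists An))// mulrC divfK//.
by rewrite pnatr_eq0 -lt0n.
Unshelve. all: by end_near. Qed.

End vanishing.

(** * Nets of balls in the sup norm *)

Section rate.
Context {R : realType}.

Lemma rate_gt0 n : (0 < n)%N -> 0 < rate n :> R.
Proof. by move=> n0; rewrite invr_gt0 sqrtr_gt0 ltr0n. Qed.

Lemma sqr_rate n : rate n ^+ 2 = n%:R^-1 :> R.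
Proof. by rewrite exprVn sqr_sqrtr. Qed.

Lemma cvg_rate : (rate : nat -> R) @ \oo --> 0.
Proof.
apply/cvgr0Pnorm_le => e e0.
near=> n; have n0 : (0 < n)%N by near: n; exists 1%N.
rewrite ger0_norm ?rate_ge0// -(ler_pXn2r (ltn0Sn 1)) ?nnegrE ?rate_ge0//;
  last exact: ltW.
rewrite sqr_rate invf_ple ?posrE ?ltr0n ?exprn_gt0//.
by apply: ltW; near: n; exact: nbhs_infty_gtr.
Unshelve. all: by end_near. Qed.

End rate.

Section column_norm.
Context {R : realType} (p : nat).
Implicit Types v : 'cV[R]_p.

Lemma ler_cvnormP v (c : R) : 0 <= c ->
  (forall j, `|v j ord0| <= c) <-> `|v| <= c.
Proof.
move=> c0; rewrite [`|v|]mx_normrE; split=> [vc|/bigmax_leP[_ vc] j].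
  by apply: bigmax_le => // -[i k] _ /=; rewrite ord1.
by have := vc (j, ord0) isT.
Qed.

Lemma cvnorm_coord v j : `|v j ord0| <= `|v|.
Proof. exact: (iffRL (ler_cvnormP v (normr_ge0 v)) (lexx _)). Qed.

Lemma cvnorm_le_enorm v : `|v| <= enorm v.
Proof.
apply/ler_cvnormP; first exact: sqrtr_ge0.
move=> j; rewrite -sqrtr_sqr ler_wsqrtr// (bigD1 j)//= lerDl.
by apply: sumr_ge0 => i _; exact: sqr_ge0.
Qed.

Lemma enorm_le_cvnorm v : enorm v <= p%:R * `|v|.
Proof.
have pv : 0 <= p%:R * `|v| by rewrite mulr_ge0.
rewrite -(ger0_norm pv) -sqrtr_sqr ler_wsqrtr//.
apply: (@le_trans _ _ (\sum_(j < p) `|v| ^+ 2)).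
  apply: ler_sum => j _; rewrite -real_normK ?num_real// lerXn2r ?nnegrE//.
  exact: cvnorm_coord.
rewrite sumr_const card_ord exprMn -[leLHS]mulr_natl ler_wpM2r ?sqr_ge0//.
case: p => [|n]; first by rewrite sqr_ge0.
by rewrite expr2 ler_peMl// ler1n.
Qed.

Lemma cvnorm_mulmx q (A : 'M[R]_(q, p)) v :
  `|A *m v| <= (\sum_i \sum_j `|A i j|) * `|v|.
Proof.
have S0 i : 0 <= \sum_j `|A i j| by rewrite sumr_ge0.
rewrite [`|A *m v|]mx_normrE; apply: bigmax_le => [|[i k] _ /=].
  by rewrite mulr_ge0// sumr_ge0.
rewrite mxE ord1 (le_trans (ler_norm_sum _ _ _))//.
apply: (@le_trans _ _ ((\sum_j `|A i j|) * `|v|)).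
  rewrite mulr_suml; apply: ler_sum => j _.
  by rewrite normrM ler_wpM2l// cvnorm_coord.
rewrite ler_wpM2r// (bigD1 i)//= lerDl; exact: sumr_ge0.
Qed.

End column_norm.

Section net.
Context {R : realType}.

Lemma grid_approx (M : nat) (x : R) : (0 < M)%N -> `|x| <= 1 ->
  exists z : 'I_(2 * M).+1, `|x - (z%:R - M%:R) / M%:R| <= M%:R^-1.
Proof.
move=> M0 x1; have M0' : 0 < M%:R :> R by rewrite ltr0n.
have /andP[lex xle] : -1 <= x <= 1 by rewrite -ler_norml.
pose y := M%:R * x + M%:R.
have y0 : 0 <= y by rewrite /y -[X in _ + X]mulr1 -mulrDr mulr_ge0//; lra.
have yM : y < (2 * M).+1%:R.
  rewrite -natr1 natrM; have : M%:R * x <= M%:R * 1 by rewrite ler_pM2l.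
  rewrite /y; lra.
have zM : (truncn y < (2 * M).+1)%N by rewrite truncn_lt_nat.
exists (Ordinal zM) => /=.
have /andP[z1 z2] := truncn_itv y0.
have -> : x - ((truncn y)%:R - M%:R) / M%:R = (y - (truncn y)%:R) / M%:R.
  by rewrite /y; field; rewrite gt_eqF.
rewrite normrM [X in _ * X]ger0_norm ?invr_ge0 ?ler0n// ler_piMl ?invr_ge0//.
rewrite ger0_norm ?subr_ge0//; move: z2; rewrite -natr1; lra.
Qed.

(** The points s * (z - M) / M with integer coordinates 0 <= z <= 2 M: the net
    of mesh s / M in the cube of half-side s, whose cardinality does not depend
    on s. *)
Definition grid p (M : nat) (s : R) (z : {ffun 'I_p -> 'I_(2 * M).+1}) :
  'cV[R]_p := \col_j (s * (((z j)%:R - M%:R) / M%:R)).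

Lemma norm_grid p M s (z : {ffun 'I_p -> 'I_(2 * M).+1}) : 0 <= s ->
  `|grid s z| <= s.
Proof.
move=> s0; apply/ler_cvnormP => // j; rewrite mxE.
case: M z => [|M] z; first by rewrite invr0 mulr0 mulr0 normr0.
rewrite normrM ger0_norm// ler_piMr// normrM.
rewrite [X in _ * X]ger0_norm ?invr_ge0// ler_pdivrMr ?ltr0n// mul1r.
have : (z j)%:R <= (2 * M.+1)%:R :> R by rewrite ler_nat -ltnS.
rewrite ler_norml natrM => zM; have := ler0n R (z j); lra.
Qed.

Lemma grid_cover p M s (v : 'cV[R]_p) : (0 < M)%N -> 0 < s -> `|v| <= s ->
  exists z : {ffun 'I_p -> 'I_(2 * M).+1}, `|v - grid s z| <= s / M%:R.
Proof.
move=> M0 s0 vs.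
have /choice[z zP] j : exists z : 'I_(2 * M).+1,
    `|v j ord0 / s - (z%:R - M%:R) / M%:R| <= M%:R^-1.
  apply: grid_approx => //; rewrite normrM normfV ler_pdivrMr ?normr_gt0 ?gt_eqF//.
  by rewrite mul1r (le_trans (cvnorm_coord v j))// (le_trans vs)// ler_norm.
exists [ffun j => z j]; apply/ler_cvnormP.
  by rewrite divr_ge0// ltW.
move=> j; rewrite !mxE ffunE.
have -> : v j ord0 - s * (((z j)%:R - M%:R) / M%:R) =
    s * (v j ord0 / s - ((z j)%:R - M%:R) / M%:R).
  by rewrite mulrBr [s * (_ / s)]mulrCA divff ?mulr1 ?gt_eqF.
by rewrite normrM gtr0_norm// ler_pM2l.
Qed.

(** The shell of a point u at distance at most s: since the radius of the shell is
    at most 2 * u, an error relative to the radius is one relative to u. *)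
Lemma dyadic_shell (K : nat) (s u : R) : 0 <= u -> u <= s ->
  u <= s * 2^-1 ^+ K \/
  exists2 k : 'I_K, u <= s * 2^-1 ^+ k & s * 2^-1 ^+ k <= 2 * u.
Proof.
move=> u0 us; elim: K => [|K [uK|[k uk ku]]]; first by left; rewrite expr0 mulr1.
- have [|h] := leP u (s * 2^-1 ^+ K.+1); first by left.
  right; exists ord_max => //=; move: h; rewrite exprSr; lra.
- by right; exists (widen_ord (leqnSn K) k).
Qed.

End net.

(** * Uniform deviations of a Lipschitz family *)

Section deviation.
Context {R : realType} d d' (T : measurableType d) (T' : measurableType d').
Variables (Q : probability T' R) (n : nat) (X : 'I_n -> T -> T').

Definition deviation (h : T' -> R) (t : T) : R :=
  sample_mean X h t - fine 'E_Q[h]%E.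

Lemma sample_meanB (g h : T' -> R) t :
  sample_mean X (fun x => g x - h x) t = sample_mean X g t - sample_mean X h t.
Proof. by rewrite /sample_mean sumrB mulrBr. Qed.

Lemma fine_expectationB (g h : T' -> R) :
    g \in Lfun Q 2%:E -> h \in Lfun Q 2%:E ->
  fine 'E_Q[fun x => (g x - h x)%R]%E = fine 'E_Q[g]%E - fine 'E_Q[h]%E.
Proof.
by move=> g2 h2; rewrite unlock -RintegralB//; exact: Lfun2_integrable.
Qed.

Lemma fine_expectation_lipschitz (g l : T' -> R) (c : R) : 0 <= c ->
    g \in Lfun Q 2%:E -> l \in Lfun Q 2%:E -> (forall x, `|g x| <= c * l x) ->
  `|fine 'E_Q[g]%E| <= c * fine 'E_Q[l]%E.
Proof.
move=> c0 g2 l2 gl; rewrite unlock -[fine _]/(\int[Q]_x g x).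
have ig := Lfun2_integrable g2; have il := Lfun2_integrable l2.
apply: (le_trans (le_normr_Rintegral measurableT ig)).
rewrite -[X in c * X]/(\int[Q]_x l x) -RintegralZl//.
apply: le_Rintegral => //.
- exact: integrable_norm.
- exact: (integrableZl measurableT c il).
Qed.

Lemma deviationB (g h : T' -> R) t :
    g \in Lfun Q 2%:E -> h \in Lfun Q 2%:E ->
  deviation (fun x => g x - h x) t = deviation g t - deviation h t.
Proof.
by move=> g2 h2; rewrite /deviation sample_meanB fine_expectationB//; lra.
Qed.

(** A Lipschitz envelope l is inherited by the sample mean and by the
    expectation alike; the sample mean of l is written as its deviation plus
    its mean, which are the two quantities that can be bounded. *)
Lemma deviation_lipschitz (g l : T' -> R) (c : R) t : 0 <= c ->
    g \in Lfun Q 2%:E -> l \in Lfun Q 2%:E -> (forall x, `|g x| <= c * l x) ->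
  `|deviation g t| <= c * (deviation l t + 2 * fine 'E_Q[l]%E).
Proof.
move=> c0 g2 l2 gl; rewrite /deviation (le_trans (ler_normB _ _))//.
have Eg := fine_expectation_lipschitz c0 g2 l2 gl.
suff : `|sample_mean X g t| <= c * sample_mean X l t by lra.
rewrite /sample_mean normrM ger0_norm ?invr_ge0//.
rewrite mulrCA ler_wpM2l ?invr_ge0// mulr_sumr.
by rewrite (le_trans (ler_norm_sum _ _ _))// ler_sum.
Qed.

End deviation.

Section uniform_deviation.
Context {R : realType} (d : nat -> measure_display) d'
  (T : forall n, measurableType (d n)) (T' : measurableType d').
Variables (P : forall n, probability (T n) R) (Q : nat -> probability T' R).
Variable X : forall n, 'I_n -> {mfun T n >-> T'}.
Arguments X : clear implicits.
Hypothesis XQ : forall n, iid (P n) (Q n) (X n).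

Lemma deviation_outer_tail n (h : T' -> R) (B c : R) : (0 < n)%N -> 0 < c ->
    h \in Lfun (Q n) 2%:E -> ('E_(Q n)[fun x => (h x ^+ 2)%R] <= B%:E)%E ->
  (mu_ext (P n) [set t | (c <= `|deviation (Q n) (X n) h t|)%R] <=
     (B / (n%:R * c ^+ 2))%:E)%E.
Proof.
move=> n0 c0 h2 hB; rewrite measurable_mu_extE; last first.
  rewrite -[X in measurable X]setTI.
  have mD : measurable_fun setT (fun t => `|deviation (Q n) (X n) h t|).
    apply: measurableT_comp => //; apply: measurable_funB => //.
    exact/measurable_sample_mean/Lfun2_measurable/h2.
  have := mD measurableT _ (measurable_itv `[c, +oo[).
  by rewrite (_ : _ @^-1` _ = [set t | (c <= `|deviation (Q n) (X n) h t|)%R])//;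
    apply/seteqP; split=> t /=; rewrite in_itv/= andbT.
rewrite (le_trans (sample_mean_deviation n0 (XQ n) h2 c0))//.
rewrite [B / _]mulrC EFinM.
by rewrite lee_pmul2l// lte_fin invr_gt0 mulr_gt0 ?exprn_gt0// ltr0n.
Qed.

Context (p : nat).
Variables (theta0 : 'cV[R]_p) (delta B : R) (f : 'cV[R]_p -> T' -> R).
Variable l : T' -> R.
Hypothesis delta0 : 0 < delta.
Hypothesis mf : forall th, `|th - theta0| <= delta -> measurable_fun setT (f th).
Hypothesis ml : measurable_fun setT l.
Hypothesis l0 : forall x, 0 <= l x.
Hypothesis lB : forall n, (0 < n)%N ->
  ('E_(Q n)[fun x => (l x ^+ 2)%R] <= B%:E)%E.
Hypothesis fl : forall th1 th2 x, `|th1 - theta0| <= delta ->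
  `|th2 - theta0| <= delta -> `|f th1 x - f th2 x| <= `|th1 - th2| * l x.

Let g th x := f th x - f theta0 x.

(** The net argument described at the top of the file.  The factor C bounds
    P_n l + Q_n l outside [badl], the mesh 1 / M is chosen so that the Lipschitz
    error between a shell and its net stays below eta, and the number K n of
    shells is such that the innermost ball has radius O(rate n). *)
Lemma uniform_deviation (eta : R) : 0 < eta ->
  vanishing P (fun n => [set t | exists2 th, `|th - theta0| <= delta &
    eta * (`|th - theta0| + rate n) < `|deviation (Q n) (X n) (g th) t|]).
Proof.
move=> eta0.
have B0 : 0 <= B.
  rewrite -lee_fin; apply: le_trans (lB (ltn0Sn 0)).
  by apply: expectation_ge0 => x; exact: sqr_ge0.
have d00 : `|theta0 - theta0| <= delta by rewrite subrr normr0 ltW.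
have l2 n : (0 < n)%N -> l \in Lfun (Q n) 2%:E.
  by move=> n0; apply: measurable_Lfun2 => //; rewrite (le_lt_trans (lB n0)) ?ltry.
have gl th x : `|th - theta0| <= delta -> `|g th x| <= `|th - theta0| * l x.
  by move=> thd; exact: fl.
have gl2 n th : (0 < n)%N -> `|th - theta0| <= delta ->
    ('E_(Q n)[fun x => (g th x ^+ 2)%R] <= (`|th - theta0| ^+ 2 * B)%:E)%E.
  move=> n0 thd.
  have mg : measurable_fun setT (g th) by apply: measurable_funB; exact: mf.
  apply: (@le_trans _ _ ((`|th - theta0| ^+ 2)%:E * 'E_(Q n)[fun x => (l x ^+ 2)%R])%E).
    have l1 := Lfun2_mul_Lfun1 (l2 _ n0) (l2 _ n0).
    rewrite (_ : (fun x => l x ^+ 2) = l \* l); last first.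
      by apply/funext => x; rewrite /= expr2.
    rewrite -expectationZl//; apply: expectation_le.
    - exact: measurable_funX.
    - by apply: measurable_funM => //; exact: measurable_funM.
    - by move=> x; exact: sqr_ge0.
    - by move=> x /=; rewrite !mulr_ge0 ?sqr_ge0.
    apply: aeW => x /=; rewrite -expr2 mulrC -exprMn.
    by rewrite -real_normK ?num_real// lerXn2r ?nnegrE ?mulr_ge0// gl.
  by rewrite [(_ * B)%:E]EFinM lee_wpmul2l// ?lB// lee_fin sqr_ge0.
have g2 n th : (0 < n)%N -> `|th - theta0| <= delta -> g th \in Lfun (Q n) 2%:E.
  move=> n0 thd; apply: measurable_Lfun2; last first.
    by rewrite (le_lt_trans (gl2 _ _ n0 thd)) ?ltry.
  by apply: measurable_funB; exact: mf.
have El n : (0 < n)%N -> fine 'E_(Q n)[l]%E <= 1 + B.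
  move=> n0; rewrite -lee_fin fineK ?Lfun2_expectation_fin_num ?l2//.
  have ll := Lfun2_mul_Lfun1 (l2 _ n0) (l2 _ n0).
  apply: (@le_trans _ _ 'E_(Q n)[(cst 1 \+ (l \* l))%R]%E).
    apply: expectation_le => //.
    - by apply: measurable_funD => //; exact: measurable_funM.
    - by move=> x /=; rewrite addr_ge0 ?mulr_ge0.
    - by apply: aeW => x /=; nra.
  rewrite expectationD//; last exact: Lfun_cst.
  by rewrite expectation_cst EFinD leeD2l// (le_trans _ (lB n0))//.
pose C := 1 + 2 * (1 + B).
have C0 : 0 < C by rewrite /C; lra.
pose M := (truncn (2 * (1 + C) / eta)).+1.
have M0 : (0 < M)%N by [].
have M0' : 0 < M%:R :> R by rewrite ltr0n.
have CM : 2 * (1 + C) <= eta * M%:R.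
  by rewrite [eta * _]mulrC -ler_pdivrMr//; apply/ltW; exact: truncnS_gt.
pose a := C * delta / eta.
have a0 : 0 <= a by rewrite divr_ge0 ?mulr_ge0// ltW.
pose K n := (truncn (a * Num.sqrt n%:R)).+1.
(* 2 ^ K n >= K n already exceeds a * sqrt n, so K n may be taken of order
   sqrt n, and K n / n tends to 0. *)
have Ka n : (0 < n)%N -> C * (delta * 2^-1 ^+ K n) <= eta * rate n.
  move=> n0; have n0' : 0 < Num.sqrt n%:R :> R by rewrite sqrtr_gt0 ltr0n.
  have aK : a * Num.sqrt n%:R <= 2 ^+ K n.
    apply: (@le_trans _ _ (K n)%:R); first exact/ltW/truncnS_gt.
    by rewrite -natrX ler_nat ltnW// ltn_expl.
  rewrite mulrA exprVn ler_pdivrMr ?exprn_gt0//.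
  have -> : C * delta = eta * rate n * (a * Num.sqrt n%:R).
    by rewrite /a /rate; field; rewrite !gt_eqF.
  by rewrite ler_wpM2l// mulr_ge0 ?rate_ge0// ltW.
pose G := {ffun 'I_p -> 'I_(2 * M).+1}.
pose s k : R := delta * 2^-1 ^+ k.
have s0 k : 0 < s k by rewrite mulr_gt0// exprn_gt0// invr_gt0.
have sd k : s k <= delta.
  by rewrite /s ler_piMr ?(ltW delta0)//; apply: exprn_ile1; lra.
pose w k (z : G) : 'cV[R]_p := theta0 + grid (s k) z.
have wE k z : `|w k z - theta0| <= s k.
  by rewrite /w addrC addKr norm_grid// ltW.
pose badl n := [set t | 1 <= `|deviation (Q n) (X n) l t|].
pose badg n := [set t | exists kz : 'I_(K n) * G,
  s kz.1 / M%:R <= `|deviation (Q n) (X n) (g (w kz.1 kz.2)) t|].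
have vl : vanishing P badl.
  apply: (@vanishing_le _ _ _ _ _ (fun n => B * (rate n * rate n))).
    rewrite -[X in _ --> X](mulr0 B) -[X in B * X](mulr0 0).
    by apply: cvgM; [exact: cvg_cst|apply: cvgM; exact: cvg_rate].
  near=> n; have n0 : (0 < n)%N by near: n; exists 1%N.
  have := deviation_outer_tail n0 ltr01 (l2 _ n0) (lB n0).
  by rewrite expr1n mulr1 -sqr_rate expr2.
have vg : vanishing P badg.
  pose c := #|G|%:R * (B * M%:R ^+ 2).
  apply: (@vanishing_le _ _ _ _ _
      (fun n => c * (a * rate n + rate n * rate n))).
    rewrite -[X in _ --> X](mulr0 c) -[X in c * X](addr0 0).
    rewrite -[X in c * (X + _)](mulr0 a) -[X in c * (_ + X)](mulr0 0).
    apply: cvgM; first exact: cvg_cst.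
    apply: cvgD; apply: cvgM; by [exact: cvg_cst|exact: cvg_rate].
  near=> n; have n0 : (0 < n)%N by near: n; exists 1%N.
  have n0' : n%:R != 0 :> R by rewrite pnatr_eq0 -lt0n.
  have tail (kz : 'I_(K n) * G) : (mu_ext (P n) [set t |
      (s kz.1 / M%:R <= `|deviation (Q n) (X n) (g (w kz.1 kz.2)) t|)%R] <=
      (B * M%:R ^+ 2 / n%:R)%:E)%E.
    have wd := le_trans (wE kz.1 kz.2) (sd kz.1).
    (* The radius of the shell cancels between variance and threshold. *)
    have -> : B * M%:R ^+ 2 / n%:R =
        s kz.1 ^+ 2 * B / (n%:R * (s kz.1 / M%:R) ^+ 2).
      by field; rewrite n0' !gt_eqF.
    apply: deviation_outer_tail => //.
    - by rewrite divr_gt0.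
    - exact: g2.
    - apply: (le_trans (gl2 _ _ n0 wd)); rewrite lee_fin ler_wpM2r//.
      by rewrite lerXn2r ?nnegrE// ltW.
  apply: (le_trans (mu_ext_exists tail)); rewrite lee_fin.
  rewrite card_prod card_ord natrM.
  have aK : (K n)%:R <= a * Num.sqrt n%:R + 1.
    by rewrite -natr1 lerD2r truncn_le mulr_ge0// sqrtr_ge0.
  have -> : a * rate n + rate n * rate n = (a * Num.sqrt n%:R + 1) / n%:R.
    rewrite -sqr_rate expr2 mulrDl mul1r /rate; congr (_ + _).
    by field; rewrite sqrtr_eq0 -ltNge ltr0n.
  have -> : (K n)%:R * #|G|%:R * (B * M%:R ^+ 2 / n%:R) = (K n)%:R * (c / n%:R).
    by rewrite /c; field.
  rewrite [leRHS]mulrCA ler_wpM2r// divr_ge0// /c.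
  by rewrite !mulr_ge0// sqr_ge0.
(* From here on, a fixed outcome outside both bad events. *)
apply: vanishing_sub (vanishingU vl vg) _.
near=> n; have n0 : (0 < n)%N by near: n; exists 1%N.
move=> t [th thd]; apply: contraPP => /not_orP[/negP nl ng].
apply/negP; rewrite -leNgt.
have lC : deviation (Q n) (X n) l t + 2 * fine 'E_(Q n)[l]%E <= C.
  have := El _ n0; move: nl; rewrite -ltNge => /ltW/ler_normlP[_].
  rewrite /C; lra.
have near_dev th' : `|th' - theta0| <= delta ->
    `|deviation (Q n) (X n) (g th) t| <=
    `|deviation (Q n) (X n) (g th') t| + `|th - th'| * C.
  move=> thd'.
  have gg : (fun x => g th x - g th' x) \in Lfun (Q n) 2%:E.
    by apply: Lfun2B; exact: g2.
  have ggl x : `|g th x - g th' x| <= `|th - th'| * l x.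
    rewrite (_ : g th x - g th' x = f th x - f th' x) ?fl//.
    rewrite /g; lra.
  have := deviation_lipschitz (X n) t (normr_ge0 _) gg (l2 _ n0) ggl.
  rewrite deviationB ?g2// => dl.
  rewrite -[X in `|X| <= _](subrK (deviation (Q n) (X n) (g th') t)).
  rewrite (le_trans (ler_normD _ _))// addrC lerD2l (le_trans dl)//.
  by rewrite ler_wpM2l.
(* Inside the innermost ball the net point is theta0 itself. *)
have [uK|[k uk ku]] := dyadic_shell (K n) (normr_ge0 _) thd.
  have := near_dev _ d00.
  rewrite (_ : deviation _ _ (g theta0) t = 0) ?normr0 ?add0r; last first.
    have gg0 := deviation_lipschitz (X n) t (normr_ge0 _) (g2 _ _ n0 d00)
      (l2 _ n0) (fun x => gl _ x d00).
    by apply/normr0_eq0/le_anti; rewrite normr_ge0 (le_trans gg0)// subrr normr0 mul0r.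
  move=> /le_trans; apply; rewrite [eta * _]mulrDr.
  have KK := Ka _ n0.
  have : C * `|th - theta0| <= eta * rate n.
    by apply: le_trans KK; rewrite ler_pM2l.
  have : 0 <= eta * `|th - theta0| by rewrite mulr_ge0// ltW.
  lra.
have [z zP] := grid_cover M0 (s0 k) uk.
have thw : `|th - w k z| <= s k / M%:R by rewrite /w opprD addrA.
have := near_dev _ (le_trans (wE k z) (sd k)).
move=> /le_trans; apply.
have : `|deviation (Q n) (X n) (g (w k z)) t| <= s k / M%:R.
  rewrite leNgt; apply/negP => /ltW dk; apply: ng; by exists (k, z).
have : `|th - w k z| * C <= s k / M%:R * C by rewrite ler_pM2r.
have : s k / M%:R * (1 + C) <= eta * `|th - theta0|.
  rewrite mulrAC ler_pdivrMr//.
  have : s k * (1 + C) <= 2 * `|th - theta0| * (1 + C) by rewrite ler_pM2r//; lra.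
  have : (2 * (1 + C)) * `|th - theta0| <= eta * M%:R * `|th - theta0|.
    by rewrite ler_wpM2r.
  lra.
have : 0 <= eta * rate n by rewrite mulr_ge0 ?rate_ge0// ltW.
rewrite [eta * (_ + _)]mulrDr; lra.
Unshelve. all: by end_near. Qed.

End uniform_deviation.

(** * Expectations under the local alternative *)

Section mixture.
Context {R : realType} d (T : measurableType d) (mu G : probability T R)
  (n : nat).
Let Q : probability T R := local_alternative mu G n.

Lemma ge0_integral_mixture (f : T -> \bar R) :
    measurable_fun setT f -> (forall x, 0 <= f x)%E ->
  (\int[Q]_x f x =
    (1 - rate n)%:E * \int[mu]_x f x + (rate n)%:E * \int[G]_x f x)%E.
Proof.
move=> mf f0; rewrite ge0_integral_measure_add//.
by rewrite !ge0_integral_mscale.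
Qed.

Lemma ge0_expectation_mixture_le (f : T -> R) :
    measurable_fun setT f -> (forall x, 0 <= f x) ->
  ('E_Q[f] <= 'E_mu[f] + 'E_G[f])%E.
Proof.
move=> mf f0; rewrite unlock ge0_integral_mixture; last 2 first.
- exact/measurable_EFinP.
- by move=> x; rewrite lee_fin.
have r0 := @rate_ge0 R n; have r1 := @onem_rate_ge0 R n.
have I0 (nu : probability T R) : (0 <= \int[nu]_x (f x)%:E)%E.
  by apply: integral_ge0 => x _; rewrite lee_fin.
by apply: leeD; rewrite -[leRHS]mul1e lee_wpmul2r// lee_fin; lra.
Qed.

Lemma Lfun2_mixture (f : T -> R) : f \in Lfun mu 2%:E -> f \in Lfun G 2%:E ->
  f \in Lfun Q 2%:E.
Proof.
move=> fmu fG; have mf := Lfun2_measurable fmu.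
apply: measurable_Lfun2 => //.
apply: le_lt_trans (ge0_expectation_mixture_le _ _) _.
- exact: measurable_funX.
- by move=> x; exact: sqr_ge0.
by rewrite lte_add_pinfty// ltey_eq Lfun2_sqr_fin_num.
Qed.

Lemma fine_expectation_mixture (f : T -> R) :
    f \in Lfun mu 2%:E -> f \in Lfun G 2%:E ->
  fine 'E_Q[f]%E =
    (1 - rate n) * fine 'E_mu[f]%E + rate n * fine 'E_G[f]%E.
Proof.
move=> fmu fG; have mf := Lfun2_measurable fmu.
have mF : measurable_fun setT (EFin \o f) by exact/measurable_EFinP.
have imu := Lfun2_integrable fmu; have iG := Lfun2_integrable fG.
have iQ := Lfun2_integrable (Lfun2_mixture fmu fG).
rewrite unlock (integralE Q) (integralE mu) (integralE G).
have fp : measurable_fun setT (EFin \o f)^\+%E by exact: measurable_funepos.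
have fn : measurable_fun setT (EFin \o f)^\-%E by exact: measurable_funeneg.
rewrite !ge0_integral_mixture//.
rewrite -(fineK (integrable_pos_fin_num measurableT imu)).
rewrite -(fineK (integrable_neg_fin_num measurableT imu)).
rewrite -(fineK (integrable_pos_fin_num measurableT iG)).
rewrite -(fineK (integrable_neg_fin_num measurableT iG)).
rewrite -!EFinM -!EFinD /=.
lra.
Qed.

End mixture.

(** * Lipschitz families and first-order expansions *)

Section lipschitz_family.
Context {R : realType} (p : nat) d (T : measurableType d) (nu : probability T R)
  (psi : 'cV[R]_p -> T -> 'cV[R]_p) (theta0 : 'cV[R]_p) (delta : R)
  (l : T -> R).
Hypotheses (l0 : forall x, 0 <= l x) (l2 : l \in Lfun nu 2%:E).
Hypothesis mpsi : forall th, `|th - theta0| <= delta -> forall j,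
  measurable_fun setT (fun x => psi th x j ord0).
Hypothesis psi_lip : forall th x, `|th - theta0| <= delta ->
  `|psi th x - psi theta0 x| <= `|th - theta0| * l x.
Hypothesis psi0 : forall j, (fun x => psi theta0 x j ord0) \in Lfun nu 2%:E.

Lemma lipschitz_increment th x j : `|th - theta0| <= delta ->
  `|psi th x j ord0 - psi theta0 x j ord0| <= `|th - theta0| * l x.
Proof.
move=> thd; apply: le_trans (psi_lip x thd).
by have := cvnorm_coord (psi th x - psi theta0 x) j; rewrite !mxE.
Qed.

Lemma lipschitz_Lfun2 th j : `|th - theta0| <= delta ->
  (fun x => psi th x j ord0) \in Lfun nu 2%:E.
Proof.
move=> thd.
pose g x := psi th x j ord0 - psi theta0 x j ord0.
have mg : measurable_fun setT g.
  by apply: measurable_funB; [exact: mpsi|exact: Lfun2_measurable (psi0 j)].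
have c2 : (fun x => `|th - theta0| * l x) \in Lfun nu 2%:E.
  rewrite (_ : (fun _ => _) = `|th - theta0| \o* l); last first.
    by apply/funext => x; rewrite /= mulrC.
  by apply: Lfun_scale => //; rewrite ler1n.
have g2 : g \in Lfun nu 2%:E.
  apply: measurable_Lfun2 => //.
  apply: (@le_lt_trans _ _ 'E_nu[fun x => ((`|th - theta0| * l x) ^+ 2)%R]%E).
    apply: expectation_le => //.
    - exact: measurable_funX.
    - by apply: measurable_funX; exact: Lfun2_measurable c2.
    - by move=> x; exact: sqr_ge0.
    - by move=> x; exact: sqr_ge0.
    apply: aeW => x /=; rewrite -[leLHS]real_normK ?num_real//.
    by rewrite lerXn2r ?nnegrE ?mulr_ge0// lipschitz_increment.
  by rewrite ltey_eq Lfun2_sqr_fin_num.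
rewrite (_ : (fun _ => _) = g + (fun x => psi theta0 x j ord0)); last first.
  by apply/funext => x; rewrite /g /= subrK.
by rewrite rpredD// lee1n.
Qed.

Lemma lipschitz_vexpectation th : `|th - theta0| <= delta ->
  `|vexpectation nu (psi th) - vexpectation nu (psi theta0)| <=
  `|th - theta0| * fine 'E_nu[l]%E.
Proof.
move=> thd; apply/ler_cvnormP.
  by rewrite mulr_ge0// fine_ge0// expectation_ge0.
move=> j; rewrite !mxE -fine_expectationB ?lipschitz_Lfun2//.
apply: fine_expectation_lipschitz => //.
- by apply: Lfun2B => //; exact: lipschitz_Lfun2.
- by move=> x; exact: lipschitz_increment.
- by rewrite subrr normr0 (le_trans _ thd).
Qed.

End lipschitz_family.

Section first_order.
Context {R : realType} (p : nat).

Lemma is_diff_first_order (m : 'cV[R]_p -> 'cV[R]_p) (theta0 : 'cV[R]_p)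
    (V : 'M[R]_p) (eta : R) : 0 < eta -> is_diff theta0 m (fun h => V *m h) ->
  exists2 delta : R, 0 < delta & forall th, `|th - theta0| <= delta ->
    `|m th - (m theta0 + V *m (th - theta0))| <= eta * `|th - theta0|.
Proof.
move=> eta0 dm; have := diff_locally (@ex_diff _ _ _ _ _ _ _ dm).
rewrite (@diff_val _ _ _ _ _ _ _ dm) => /eqaddoP/(_ _ eta0).
move=> /nbhs_ballP[e /= e0 He].
exists (e / 2); first by rewrite divr_gt0.
move=> th the; rewrite -[in m th](subrK theta0 th).
apply: (He (th - theta0)).
rewrite -ball_normE /ball_ /= sub0r normrN.
by rewrite (le_lt_trans the)// ltr_pdivrMr// ltr_pMr// ltr1n.
Qed.

End first_order.

(** * Estimating equations under local alternatives *)

Section local_alternatives.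
Context {R : realType} (p : nat) d (T : measurableType d)
  (mu G : probability T R)
  (psi : 'cV[R]_p -> T -> 'cV[R]_p) (theta0 : 'cV[R]_p) (delta : R)
  (l : T -> R) (V : 'M[R]_p).
Hypothesis delta0 : 0 < delta.
Hypothesis l0 : forall x, 0 <= l x.
Hypotheses (lmu : l \in Lfun mu 2%:E) (lG : l \in Lfun G 2%:E).
Hypothesis mpsi : forall th, `|th - theta0| <= delta -> forall j,
  measurable_fun setT (fun x => psi th x j ord0).
Hypothesis psi_lip : forall th1 th2 x, `|th1 - theta0| <= delta ->
  `|th2 - theta0| <= delta -> `|psi th1 x - psi th2 x| <= `|th1 - th2| * l x.
Hypothesis psi0mu : forall j, (fun x => psi theta0 x j ord0) \in Lfun mu 2%:E.
Hypothesis psi0G : forall j, (fun x => psi theta0 x j ord0) \in Lfun G 2%:E.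
Hypothesis psi0_mean : vexpectation mu (psi theta0) = 0.
Hypothesis psi_diff :
  is_diff theta0 (fun th => vexpectation mu (psi th)) (fun h => V *m h).
Hypothesis V_unit : V \in unitmx.

Let Q n : probability T R := local_alternative mu G n.
Let g0 := vexpectation G (psi theta0).
Let bias := invmx V *m g0.
Let W := \sum_i \sum_j `|invmx V i j|.

Let W0 : 0 <= W.
Proof. by apply: sumr_ge0 => i _; apply: sumr_ge0. Qed.

Let d00 : `|theta0 - theta0| <= delta.
Proof. by rewrite subrr normr0 ltW. Qed.

Let psi_lip0 th x : `|th - theta0| <= delta ->
  `|psi th x - psi theta0 x| <= `|th - theta0| * l x.
Proof. by move=> thd; exact: psi_lip. Qed.

Let psimu th j : `|th - theta0| <= delta ->
  (fun x => psi th x j ord0) \in Lfun mu 2%:E.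
Proof. exact: (lipschitz_Lfun2 l0 lmu mpsi psi_lip0 psi0mu). Qed.

Let psiG th j : `|th - theta0| <= delta ->
  (fun x => psi th x j ord0) \in Lfun G 2%:E.
Proof. exact: (lipschitz_Lfun2 l0 lG mpsi psi_lip0 psi0G). Qed.

Lemma vexpectation_mixture n th : `|th - theta0| <= delta ->
  vexpectation (Q n) (psi th) =
    (1 - rate n) *: vexpectation mu (psi th)
    + rate n *: vexpectation G (psi th).
Proof.
by move=> thd; apply/colP => j;
  rewrite !mxE fine_expectation_mixture ?psimu ?psiG.
Qed.

(** Writing the mixture as mu + rate n * (G - mu), the mu part is differentiable
    at theta0, and the bracket moves by O(|theta - theta0|) around its value at
    theta0, an error that the factor [rate n] makes negligible. *)
Lemma drift_expansion (eta : R) : 0 < eta ->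
  exists2 e : R, 0 < e <= delta & \forall n \near \oo,
    forall th, `|th - theta0| <= e ->
    `|vexpectation (Q n) (psi th) - (V *m (th - theta0) + rate n *: g0)|
      <= eta * `|th - theta0|.
Proof.
move=> eta0; have eta2 : 0 < eta / 2 by rewrite divr_gt0.
have [e1 e10 He1] := is_diff_first_order eta2 psi_diff.
exists (Num.min e1 delta).
  by rewrite lt_min e10 delta0 ge_min lexx orbT.
pose A := fine 'E_mu[l]%E + fine 'E_G[l]%E.
have A0 : 0 <= A by rewrite addr_ge0// fine_ge0// expectation_ge0.
have rA : rate n * A @[n --> \oo] --> 0.
  rewrite -[X in _ --> X](mul0r A).
  by apply: cvgM; [exact: cvg_rate|exact: cvg_cst].
near=> n => th; rewrite le_min => /andP[the thd].
have rAn : rate n * A <= eta / 2.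
  have : `|rate n * A| <= eta / 2 by near: n; exact: cvgr0_norm_le.
  by apply: le_trans; exact: ler_norm.
have r0 := @rate_ge0 R n.
have dmu := He1 _ the; rewrite psi0_mean add0r in dmu.
have lmu' := lipschitz_vexpectation l0 lmu mpsi psi_lip0 psi0mu thd.
have lG' := lipschitz_vexpectation l0 lG mpsi psi_lip0 psi0G thd.
rewrite psi0_mean subr0 in lmu'.
rewrite vexpectation_mixture//.
set m := vexpectation mu (psi th) in dmu lmu' *.
set g := vexpectation G (psi th) in lG' *.
rewrite -/g0 in lG'.
have -> : (1 - rate n) *: m + rate n *: g - (V *m (th - theta0) + rate n *: g0)
   = (m - V *m (th - theta0)) + rate n *: ((g - g0) - m).
  by apply/colP => j; rewrite !mxE; ring.
rewrite (le_trans (ler_normD _ _))// normrZ (ger0_norm r0).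
have : `|g - g0 - m| <= `|th - theta0| * A.
  rewrite (le_trans (ler_normB _ _))// /A mulrDr addrC; exact: lerD.
move=> /(ler_wpM2l r0) gm.
have : rate n * A * `|th - theta0| <= eta / 2 * `|th - theta0|.
  by rewrite ler_wpM2r.
move: dmu gm; lra.
Unshelve. all: by end_near. Qed.

(* Multiplying a bound on V v + w + r g0 by V^(-1) turns it into the expansion
   of v; both parts of the theorem come out of this step. *)
Let solve_linear (v w : 'cV[R]_p) (r : R) :
  `|v + (invmx V *m w + r *: bias)| <= W * `|V *m v + w + r *: g0|.
Proof.
have -> : v + (invmx V *m w + r *: bias) = invmx V *m (V *m v + w + r *: g0).
  by rewrite !mulmxDr mulmxA mulVmx// mul1mx -scalemxAr addrA.
exact: cvnorm_mulmx.
Qed.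

Context (thetat : nat -> 'cV[R]_p).
Hypothesis tQ : forall n, (0 < n)%N -> expectation_is (Q n) (psi (thetat n)) 0.
Hypothesis thetat_cvg : thetat @ \oo --> theta0.

Let vexpectation_thetat n : (0 < n)%N -> vexpectation (Q n) (psi (thetat n)) = 0.
Proof. by move=> n0; apply/colP => j; rewrite mxE tQ. Qed.

(** The drift vanishes at [thetat n], so the linear part is at most
    eta |thetat n - theta0|.  This first forces |thetat n - theta0| = O(rate n),
    and then the expansion. *)
Lemma pseudo_true_expansion (eta : R) : 0 < eta -> \forall n \near \oo,
  `|(thetat n - theta0) + rate n *: bias| <= eta * rate n.
Proof.
move=> eta0; pose b := `|bias|.
have b0 : 0 <= b by exact: normr_ge0.
have W1 : 0 < W + 1 by have := W0; lra.
have b1 : 0 < b + 1 by lra.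
(* The first term makes the error at most half of |thetat n - theta0|, the
   second brings the resulting multiple of rate n below eta. *)
pose eta1 := Num.min (2^-1 / (W + 1)) (eta / (2 * (W + 1) * (b + 1))).
have eta10 : 0 < eta1 by rewrite lt_min !divr_gt0 ?mulr_gt0.
have W_eta : (W + 1) * eta1 <= 2^-1.
  by rewrite mulrC -ler_pdivlMr// ge_min lexx.
have b_eta : 2 * (W + 1) * (b + 1) * eta1 <= eta.
  by rewrite mulrC -ler_pdivlMr ?mulr_gt0// ge_min lexx orbT.
have [e /andP[e0 ed] He] := drift_expansion eta10.
near=> n; have n0 : (0 < n)%N by near: n; exists 1%N.
have te : `|thetat n - theta0| <= e by near: n; exact: cvgr_distC_le.
have He' : forall th, `|th - theta0| <= e ->
    `|vexpectation (Q n) (psi th) - (V *m (th - theta0) + rate n *: g0)|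
      <= eta1 * `|th - theta0| by near: n.
have := He' _ te; rewrite vexpectation_thetat// sub0r normrN.
have := solve_linear (thetat n - theta0) 0 (rate n).
rewrite mulmx0 add0r addr0.
set v := thetat n - theta0; set y := v + _; set D := V *m v + _ => yD Dv.
have r0 := @rate_ge0 R n.
have vy : `|v| <= `|y| + rate n * b.
  rewrite -[X in `|X| <= _](addrK (rate n *: bias)) (le_trans (ler_normB _ _))//.
  by rewrite normrZ ger0_norm.
have v0 : 0 <= `|v| by exact: normr_ge0.
have yv : `|y| <= (W + 1) * eta1 * `|v|.
  have : W * `|D| <= (W + 1) * `|D| by rewrite ler_wpM2r//; lra.
  have : (W + 1) * `|D| <= (W + 1) * (eta1 * `|v|) by rewrite ler_pM2l.
  lra.
have yv2 : `|y| <= 2^-1 * `|v| by rewrite (le_trans yv)// ler_wpM2r.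
have vb : `|v| <= 2 * (rate n * b) by lra.
have : (W + 1) * eta1 * `|v| <= (W + 1) * eta1 * (2 * (rate n * b)).
  by rewrite ler_wpM2l// mulr_ge0// ltW.
have : rate n * (2 * (W + 1) * (b + 1) * eta1) <= rate n * eta.
  by rewrite ler_wpM2l.
have : 0 <= rate n * ((W + 1) * eta1) by rewrite !mulr_ge0// ltW.
move: yv; lra.
Unshelve. all: by end_near. Qed.

Context (d' : nat -> measure_display) (S : forall n, measurableType (d' n))
  (P : forall n, probability (S n) R)
  (X : forall n, 'I_n -> {mfun S n >-> T}).
Arguments X : clear implicits.
Hypothesis XQ : forall n, iid (P n) (Q n) (X n).

Definition score n (th : 'cV[R]_p) (t : S n) : 'cV[R]_p :=
  n%:R^-1 *: \sum_(i < n) psi th (X n i t).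

(** (P_n - Q_n) psi_theta. *)
Definition centered_score n (th : 'cV[R]_p) (t : S n) : 'cV[R]_p :=
  score th t - vexpectation (Q n) (psi th).

Let centered_scoreE n th (t : S n) j :
  centered_score th t j ord0 =
    deviation (Q n) (X n) (fun x => psi th x j ord0) t.
Proof. by rewrite !mxE summxE. Qed.

Let psiQ n th j : `|th - theta0| <= delta ->
  (fun x => psi th x j ord0) \in Lfun (Q n) 2%:E.
Proof. by move=> thd; apply: Lfun2_mixture; [exact: psimu|exact: psiG]. Qed.

Lemma uniform_score_increment (eta : R) : 0 < eta ->
  vanishing P (fun n => [set t | exists2 th, `|th - theta0| <= delta &
    eta * (`|th - theta0| + rate n) <
      `|centered_score th t - centered_score theta0 t|]).
Proof.
move=> eta0.
pose B := fine ('E_mu[fun x => (l x ^+ 2)%R] + 'E_G[fun x => (l x ^+ 2)%R])%E.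
have lB n : (0 < n)%N -> ('E_(Q n)[fun x => (l x ^+ 2)%R] <= B%:E)%E.
  move=> _; rewrite /B fineK ?fin_numD ?Lfun2_sqr_fin_num//.
  apply: ge0_expectation_mixture_le => [|x]; last exact: sqr_ge0.
  exact/measurable_funX/Lfun2_measurable/lmu.
have psi_lip_j j th1 th2 x : `|th1 - theta0| <= delta ->
    `|th2 - theta0| <= delta ->
    `|psi th1 x j ord0 - psi th2 x j ord0| <= `|th1 - th2| * l x.
  move=> h1 h2; apply: le_trans (psi_lip x h1 h2).
  by have := cvnorm_coord (psi th1 x - psi th2 x) j; rewrite !mxE.
have U (j : 'I_p) := uniform_deviation XQ delta0
  (fun th thd => mpsi thd j) (Lfun2_measurable lmu) l0 lB (psi_lip_j j) eta0.
apply: vanishing_sub (vanishing_exists U) _.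
near=> n => t [th thd]; apply: contraPP => nU; apply/negP; rewrite -leNgt.
apply/ler_cvnormP.
  by rewrite mulr_ge0 ?addr_ge0 ?rate_ge0// ltW.
move=> j; rewrite leNgt; apply/negP => lt_j; apply: nU; exists j; exists th => //.
have <- : (centered_score th t - centered_score theta0 t) j ord0 =
    deviation (Q n) (X n) (fun x => psi th x j ord0 - psi theta0 x j ord0) t.
  by rewrite deviationB ?psiQ// -!centered_scoreE !mxE.
exact: lt_j.
Unshelve. all: by end_near. Qed.

(** The order rate n = n^(-1/2) of the fluctuations of the score at theta0:
    in the j-th coordinate, Chebyshev's inequality gives the bound B j / m^2
    for all n. *)
Lemma centered_score_tight (e : R) : 0 < e -> exists2 m : R, 0 < m &
  \forall n \near \oo, (mu_ext (P n)
    [set t | (m * rate n < `|centered_score theta0 t|)%R] <= e%:E)%E.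
Proof.
move=> e0.
pose B j := fine ('E_mu[fun x => (psi theta0 x j ord0 ^+ 2)%R]
  + 'E_G[fun x => (psi theta0 x j ord0 ^+ 2)%R])%E.
have EB0 (nu : probability T R) j :
    (0 <= 'E_nu[fun x => (psi theta0 x j ord0 ^+ 2)%R])%E.
  by apply: expectation_ge0 => x; exact: sqr_ge0.
have B0 j : 0 <= B j by rewrite fine_ge0// adde_ge0.
have QB n j :
    ('E_(Q n)[fun x => (psi theta0 x j ord0 ^+ 2)%R] <= (B j)%:E)%E.
  rewrite /B fineK ?fin_numD ?Lfun2_sqr_fin_num//.
  apply: ge0_expectation_mixture_le => [|x]; last exact: sqr_ge0.
  exact/measurable_funX/(Lfun2_measurable (psi0mu j)).
pose BS := \sum_j B j.
have BS0 : 0 <= BS by exact: sumr_ge0.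
pose m := 1 + p%:R * BS / e.
have m0' : 0 <= p%:R * BS / e by rewrite divr_ge0 ?mulr_ge0// ltW.
have m0 : 0 < m by rewrite /m; lra.
exists m => //; near=> n; have n0 : (0 < n)%N by near: n; exists 1%N.
have r0 : 0 < rate n :> R by exact: rate_gt0.
have tail j : (mu_ext (P n) [set t | (m * rate n <=
    `|deviation (Q n) (X n) (fun x => psi theta0 x j ord0) t|)%R]
    <= (BS / m)%:E)%E.
  apply: (le_trans (deviation_outer_tail XQ n0 _ (psiQ n j d00) (QB n j))).
    by rewrite mulr_gt0.
  rewrite lee_fin exprMn sqr_rate mulrCA divff ?mulr1; last first.
    by rewrite pnatr_eq0 -lt0n.
  apply: ler_pM => //.
  - by rewrite invr_ge0 sqr_ge0.
  - by rewrite /BS (bigD1 j)//= lerDl sumr_ge0.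
  rewrite lef_pV2 ?posrE ?exprn_gt0// expr2 ler_peMl ?(ltW m0)//.
  by rewrite /m lerDl.
apply: le_trans (_ : (p%:R * (BS / m))%:E <= e%:E)%E; last first.
  rewrite lee_fin mulrA ler_pdivrMr// /m mulrDr mulr1.
  by rewrite [e * _]mulrC divfK ?gt_eqF// lerDr ltW.
have := mu_ext_exists tail; rewrite card_ord; apply: le_trans.
apply: le_mu_ext => t /=; apply: contraPP => nj; apply/negP; rewrite -leNgt.
apply/ler_cvnormP; first by rewrite mulr_ge0// ltW.
move=> j; rewrite leNgt; apply/negP => /ltW lt_j; apply: nj; exists j.
by rewrite /= -centered_scoreE.
Unshelve. all: by end_near. Qed.

(** The absorption argument described at the top of the file, run on the
    complement of four events: the score at thetahat is too large, thetahat is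
    outside the ball where the drift expansion holds, the increments of the
    score are too large, or the score at theta0 exceeds m * rate n.  The first
    three are vanishing; the last has probability at most z / 2 once m is
    large, and m is fixed before eta. *)
Lemma estimator_expansion (thetahat : forall n, S n -> 'cV[R]_p) :
    negligible_in_prob P (fun n t => score (thetahat n t) t) rate ->
    negligible_in_prob P (fun n t => thetahat n t - theta0) (fun=> 1) ->
  forall e : R, 0 < e -> vanishing P (fun n => [set t | e * rate n <
    `|(thetahat n t - theta0) + (invmx V *m score (thetat n) t
        + rate n *: bias)|]).
Proof.
move=> zero consistent e e0; apply/vanishingP => z z0.
have z2 : 0 < z / 2 by rewrite divr_gt0.
have [m m0 mP] := centered_score_tight z2.
have W1 : 0 < W + 1 by have := W0; lra.
pose c := 1 + `|bias|.
have c0 : 0 < c by rewrite /c; have := normr_ge0 bias; lra.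
pose k := 3 + c + 2 * (W + 1) * (`|g0| + c + 1 + m).
have k0 : 0 < k.
  have : 0 <= (W + 1) * (`|g0| + c + 1 + m).
    by rewrite mulr_ge0 ?ltW//; have := normr_ge0 g0; lra.
  by rewrite /k; lra.
(* The bound on W * eta is what lets |D| be absorbed; the one on k * eta
   brings the final constant below e. *)
pose eta := Num.min 1 (Num.min (4^-1 / (W + 1)) (e / (2 * (W + 1) * k))).
have eta0 : 0 < eta by rewrite !lt_min ltr01 !divr_gt0 ?mulr_gt0.
have eta1 : eta <= 1 by rewrite ge_min lexx.
have W_eta : (W + 1) * eta <= 4^-1.
  by rewrite mulrC -ler_pdivlMr// !ge_min lexx orbT.
have k_eta : 2 * (W + 1) * k * eta <= e.
  by rewrite mulrC -ler_pdivlMr ?mulr_gt0// !ge_min lexx !orbT.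
have [r1 /andP[r10 r1d] He] := drift_expansion eta0.
have := vanishingU (vanishingU (zero _ eta0) (consistent _ r10))
  (uniform_score_increment eta0).
move=> /vanishingP/(_ _ z2) bad.
have tex := pseudo_true_expansion ltr01.
near=> n; have n0 : (0 < n)%N by near: n; exists 1%N.
have r0 := @rate_ge0 R n.
have te : `|thetat n - theta0| <= r1 by near: n; exact: cvgr_distC_le.
have He' : forall th, `|th - theta0| <= r1 ->
    `|vexpectation (Q n) (psi th) - (V *m (th - theta0) + rate n *: g0)|
      <= eta * `|th - theta0| by near: n.
have texn : `|(thetat n - theta0) + rate n *: bias| <= 1 * rate n by near: n.
have badn : (mu_ext (P n) (([set t | (eta * rate n < enorm (score (thetahat n t) t))%R]
    `|` [set t | (r1 * 1 < enorm (thetahat n t - theta0))%R])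
    `|` [set t | exists2 th, (`|th - theta0| <= delta)%R &
    (eta * (`|th - theta0| + rate n) <
      `|centered_score th t - centered_score theta0 t|)%R]) <= (z / 2)%:E)%E.
  by near: n.
have mPn : (mu_ext (P n)
    [set t | (m * rate n < `|centered_score theta0 t|)%R] <= (z / 2)%:E)%E by near: n.
rewrite (splitr z) EFinD; apply: le_trans (leeD badn mPn).
apply: le_trans (mu_extU _ _ _); apply: le_mu_ext => t /=.
apply: contraPP; rewrite !not_orP => -[[[h1 h2] h3] h4].
apply/negP; rewrite -leNgt.
move: h1 h2 h4 => /negP + /negP + /negP; rewrite -!leNgt mulr1 => h1 h2 h4.
have {}h1 := le_trans (cvnorm_le_enorm _) h1.
have {}h2 := le_trans (cvnorm_le_enorm _) h2.
have {}h3 th : `|th - theta0| <= delta ->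
    `|centered_score th t - centered_score theta0 t| <=
      eta * (`|th - theta0| + rate n).
  by move=> thd; rewrite leNgt; apply/negP => lt_th; apply: h3; exists th.
have dhat := h3 _ (le_trans h2 r1d); have dt := h3 _ (le_trans te r1d).
have rem := He' _ h2.
apply: le_trans (solve_linear _ _ _) _.
set v := thetahat n t - theta0 in h2 dhat rem *.
set vt := thetat n - theta0 in te texn dt.
set D := V *m v + _ + _.
have v_t : `|vt| <= c * rate n.
  rewrite -[X in `|X| <= _](addrK (rate n *: bias)) (le_trans (ler_normB _ _))//.
  by rewrite normrZ ger0_norm// /c mulrDl [X in _ <= _ + X]mulrC lerD2r.
have St : `|score (thetat n) t| <= eta * (c + 1) * rate n + m * rate n.
  have -> : score (thetat n) t = (centered_score (thetat n) t - centered_score theta0 t)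
      + centered_score theta0 t.
    by rewrite subrK /centered_score vexpectation_thetat// subr0.
  rewrite (le_trans (ler_normD _ _))// lerD// (le_trans dt)//.
  have : eta * `|vt| <= eta * (c * rate n) by rewrite ler_pM2l.
  lra.
have D1 : `|D| <= eta * (2 * `|v| + (3 + c) * rate n).
  have -> : D = score (thetahat n t) t
      - (centered_score (thetahat n t) t - centered_score theta0 t)
      + (centered_score (thetat n) t - centered_score theta0 t)
      - (vexpectation (Q n) (psi (thetahat n t)) - (V *m v + rate n *: g0)).
    rewrite /D /centered_score vexpectation_thetat//.
    by apply/colP => j; rewrite !mxE; ring.
  rewrite (le_trans (ler_normB _ _))//.
  have := ler_normD (score (thetahat n t) t
      - (centered_score (thetahat n t) t - centered_score theta0 t))
      (centered_score (thetat n) t - centered_score theta0 t).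
  have := ler_normB (score (thetahat n t) t)
    (centered_score (thetahat n t) t - centered_score theta0 t).
  have : eta * `|vt| <= eta * (c * rate n) by rewrite ler_pM2l.
  move: h1 dhat dt rem; lra.
have vD : `|v| <= (W + 1) * (`|D| + (`|g0| * rate n + `|score (thetat n) t|)).
  have -> : v = invmx V *m (D - (rate n *: g0 + score (thetat n) t)).
    rewrite /D [rate n *: g0 + _]addrC -[V *m v + _ + _]addrA addrK.
    by rewrite mulmxA mulVmx// mul1mx.
  apply: le_trans (cvnorm_mulmx _ _) _.
  apply: (@le_trans _ _ ((W + 1) * `|D - (rate n *: g0 + score (thetat n) t)|)).
    by rewrite ler_wpM2r// lerDl.
  rewrite ler_pM2l// (le_trans (ler_normB _ _))// lerD2l (le_trans (ler_normD _ _))//.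
  by rewrite normrZ ger0_norm// mulrC.
have D2 : `|D| <= 2 * (eta * k * rate n).
  have e1 : eta * (c + 1) * rate n <= (c + 1) * rate n.
    by rewrite ler_wpM2r// ler_piMl//; lra.
  have vD' : `|v| <= (W + 1) * (`|D| + (`|g0| + c + 1 + m) * rate n).
    by apply: (le_trans vD); rewrite ler_pM2l//; lra.
  have : eta * `|v| <= eta * ((W + 1) * (`|D| + (`|g0| + c + 1 + m) * rate n)).
    by rewrite ler_pM2l.
  have : (W + 1) * eta * `|D| <= 4^-1 * `|D| by rewrite ler_wpM2r.
  rewrite /k; lra.
apply: (@le_trans _ _ ((W + 1) * `|D|)); first by rewrite ler_wpM2r// lerDl.
have : (W + 1) * `|D| <= (W + 1) * (2 * (eta * k * rate n)) by rewrite ler_pM2l.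
have : 2 * (W + 1) * k * eta * rate n <= e * rate n by rewrite ler_wpM2r.
lra.
Unshelve. all: by end_near. Qed.

End local_alternatives.

(** * From Euclidean to coordinatewise moment conditions *)

Section reduction.
Context {R : realType} (p : nat) d (T : measurableType d) (nu : probability T R).

Lemma Lfun2_scaled_norm (L : T -> R) (c : R) : measurable_fun setT L ->
  ('E_nu[fun x => (L x ^+ 2)%R] < +oo)%E ->
  (fun x => c * `|L x|) \in Lfun nu 2%:E.
Proof.
move=> mL L2; rewrite (_ : (fun _ => _) = c \o* (normr \o L)); last first.
  by apply/funext => x; rewrite /= mulrC.
apply: Lfun_scale; first by rewrite ler1n.
apply: measurable_Lfun2; first exact: measurableT_comp.
rewrite (_ : (fun _ => _) = fun x => L x ^+ 2)//.
by apply/funext => x; rewrite /= real_normK// num_real.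
Qed.

Lemma Lfun2_enorm_coord (f : T -> 'cV[R]_p) :
    (forall j, measurable_fun setT (fun x => f x j ord0)) ->
    ('E_nu[fun x => (enorm (f x) ^+ 2)%R] < +oo)%E ->
  forall j, (fun x => f x j ord0) \in Lfun nu 2%:E.
Proof.
move=> mf f2 j; apply: measurable_Lfun2 => //; apply: le_lt_trans f2.
have fE x : enorm (f x) ^+ 2 = \sum_j f x j ord0 ^+ 2.
  by rewrite sqr_sqrtr// sumr_ge0// => i _; exact: sqr_ge0.
apply: expectation_le.
- exact: measurable_funX.
- under eq_fun do rewrite fE.
  by apply: measurable_sum => i; exact: measurable_funX.
- by move=> x; exact: sqr_ge0.
- by move=> x; exact: sqr_ge0.
apply: aeW => x /=; rewrite fE (bigD1 j)//= lerDl sumr_ge0// => i _.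
exact: sqr_ge0.
Qed.

End reduction.

Theorem theorem5p4 (R : realType) (Omega : pmetricType R) (p : nat)
  (Theta : set 'cV[R]_p) (mu : 'cV[R]_p -> probability (borel Omega) R)
  (theta0 : 'cV[R]_p) (G : probability (borel Omega) R)
  (psi : 'cV[R]_p -> Omega -> 'cV[R]_p)
  (U : set 'cV[R]_p) (L : Omega -> R) (V : 'M[R]_p)
  (thetat : nat -> 'cV[R]_p)
  (Q := (fun n => local_alternative (mu theta0) G n)
        : nat -> probability (borel Omega) R) :
  separable Omega ->
  open Theta ->
  Theta theta0 ->
  lipschitz_profiles G ->
  (* (b1), (b2'), and (a1) or (a2) *)
  entropy_condition Omega ->
  lipschitz_profiles (mu theta0) ->
  (exists2 alpha : R, 0 < alpha & strong_negative_type Omega alpha) \/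
    [/\ forall theta, Theta theta -> doubling (mu theta),
        doubling G &
        forall n, (0 < n)%N -> doubling (Q n)] ->
  (forall theta, Theta theta -> forall j,
     measurable_fun [set: borel Omega] (fun x => psi theta x j ord0)) ->
  (* (1) *)
  nbhs theta0 U ->
  U `<=` Theta ->
  measurable_fun [set: borel Omega] L ->
  ('E_(mu theta0)[fun x => (L x ^+ 2)%R] < +oo)%E ->
  (forall theta1 theta2 x, U theta1 -> U theta2 ->
     enorm (psi theta1 x - psi theta2 x) <= L x * enorm (theta1 - theta2)) ->
  (* (2) *)
  ('E_(mu theta0)[fun x => (enorm (psi theta0 x) ^+ 2)%R] < +oo)%E ->
  (* (3) *)
  expectation_is (mu theta0) (psi theta0) 0 ->
  is_diff theta0 (fun theta => vexpectation (mu theta0) (psi theta))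
    (fun h => V *m h) ->
  V \in unitmx ->
  (* (4) *)
  ('E_G[fun x => (L x ^+ 2)%R] < +oo)%E ->
  ('E_G[fun x => (enorm (psi theta0 x) ^+ 2)%R] < +oo)%E ->
  (forall n, (0 < n)%N -> Theta (thetat n)) ->
  (forall n, (0 < n)%N -> expectation_is (Q n) (psi (thetat n)) 0) ->
  thetat @ \oo --> theta0 ->
  (* (i) *)
  (fun n => thetat n - theta0) =
    (fun n => - (rate n *: (invmx V *m vexpectation G (psi theta0))))
    +o_\oo (rate : nat -> R)
  /\
  (* (ii) *)
  forall (d : nat -> measure_display) (T : forall n, measurableType (d n))
    (P : forall n, probability (T n) R)
    (X : forall n, 'I_n -> {mfun T n >-> borel Omega})
    (estimator : forall n, ('I_n -> Omega) -> 'cV[R]_p)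
    (thetahat := fun n (t : T n) => estimator n (fun i => X n i t)),
  (forall n, iid (P n) (Q n) (X n)) ->
  (forall n x, Theta (estimator n x)) ->
  negligible_in_prob P (fun n t =>
    n%:R^-1 *: \sum_(i < n) psi (thetahat n t) (X n i t)) rate ->
  negligible_in_prob P (fun n t => thetahat n t - theta0) (fun=> 1) ->
  negligible_in_prob P (fun n t =>
    (thetahat n t - theta0) -
    (- (n%:R^-1 *: (invmx V *m \sum_(i < n) psi (thetat n) (X n i t)))
     - rate n *: (invmx V *m vexpectation G (psi theta0)))) rate.
Proof.
move=> _ _ _ _ _ _ _ mpsi U0 UTheta mL Lmu psi_lip psimu psi_mean psi_diff Vu LG
  psiG _ tQ thetat_cvg.
have /nbhs_ballP[r /= r0 rU] := U0.
pose delta := r / 2.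
have delta0 : 0 < delta by rewrite divr_gt0.
have dU th : `|th - theta0| <= delta -> U th.
  move=> thd; apply: rU; rewrite -ball_normE /ball_ /= distrC.
  by rewrite (le_lt_trans thd)// ltr_pdivrMr// ltr_pMr// ltr1n.
have dTheta th (thd : `|th - theta0| <= delta) := UTheta _ (dU th thd).
have d00 : `|theta0 - theta0| <= delta by rewrite subrr normr0 ltW.
pose l (x : borel Omega) : R := p%:R * `|L x|.
have l0 x : 0 <= l x by rewrite mulr_ge0.
have lmu : l \in Lfun (mu theta0) 2%:E by exact: Lfun2_scaled_norm.
have lG : l \in Lfun G 2%:E by exact: Lfun2_scaled_norm.
have psi_lip' th1 th2 x : `|th1 - theta0| <= delta -> `|th2 - theta0| <= delta ->
    `|psi th1 x - psi th2 x| <= `|th1 - th2| * l x.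
  move=> /dU h1 /dU h2; apply: le_trans (cvnorm_le_enorm _) _.
  apply: (le_trans (psi_lip _ _ x h1 h2)).
  apply: (@le_trans _ _ (`|L x| * enorm (th1 - th2))).
    by rewrite ler_wpM2r ?sqrtr_ge0 ?ler_norm.
  have -> : `|th1 - th2| * l x = `|L x| * (p%:R * `|th1 - th2|) by rewrite /l; ring.
  by rewrite ler_wpM2l// enorm_le_cvnorm.
have mpsi' th (thd : `|th - theta0| <= delta) j := mpsi th (dTheta th thd) j.
have psi0mu := Lfun2_enorm_coord (mpsi' _ d00) psimu.
have psi0G := Lfun2_enorm_coord (mpsi' _ d00) psiG.
have psi0_mean : vexpectation (mu theta0) (psi theta0) = 0.
  by apply/colP => j; rewrite mxE psi_mean.
have expand := pseudo_true_expansion delta0 l0 lmu lG mpsi' psi_lip' psi0mu psi0G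
  psi0_mean psi_diff Vu tQ thetat_cvg.
split.
  apply/eqaddoP => e e0; have := expand e e0; apply: filterS => n.
  by rewrite [`|rate n|]ger0_norm ?rate_ge0// -[X in `|_ + X|]opprK.
move=> d T P X estimator XQ _ zero consistent.
have vanish := estimator_expansion delta0 l0 lmu lG mpsi' psi_lip' psi0mu psi0G
  psi0_mean psi_diff Vu tQ thetat_cvg XQ zero consistent.
move=> e e0.
have p1 : 0 < p%:R + 1 :> R by have := ler0n R p; lra.
have ep : 0 < e / (p%:R + 1) by rewrite divr_gt0.
apply: vanishing_sub (vanish _ ep) _.
near=> n => t /= lt_e.
rewrite [e / _ * _]mulrAC [e * rate n / _ < _]ltr_pdivrMr//.
apply: (lt_le_trans lt_e).
rewrite -opprD opprK scalemxAr.
apply: (le_trans (enorm_le_cvnorm _)).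
by rewrite mulrC ler_wpM2l// lerDl.
Unshelve. all: by end_near. Qed.
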